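(* There exists a universal constant $C>0$ such that for all $k\ge 1$, all $L>0$, all real $\sigma^2\ge 0$, and any probability measures $\mu_1,\dots,\mu_k$ supported on $[0,L]$ satisfying $E(\mu_i)=1$ and $Var(\mu_i)\ge\sigma^2$ for $i=1,\dots,k$, the supremum $L_k$ of the support of the measure $\mu_1\boxtimes\cdots\boxtimes\mu_k$ satisfies $$\sigma^2k\le L_k<CLk.$$
   Context: $E(\mu)$ and $Var(\mu)$ denote the mean and variance of a probability measure $\mu$ on $\mathbb{R}$. Free multiplicative convolution $\boxtimes$: for compactly supported probability measures $\mu_1,\dots,\mu_k$ on $[0,\infty)$, take free positive elements $a_1,\dots,a_k$ of a tracial $C^*$-probability space $(\mathcal{A},\tau)$ such that $a_i$ has distribution $\mu_i$ (i.e. $\tau(a_i^m)=\int x^m\,d\mu_i$ for all $m$), and let $b_i$ be the positive square root of $a_i$. Then $\mu_1\boxtimes\cdots\boxtimes\mu_k$ is the distribution of the positive element $b_1b_2\cdots b_kb_k\cdots b_2b_1$, i.e. the unique compactly supported probability measure on $[0,\infty)$ with the same moments as this element; equivalently its $n$-th moment is $\tau((a_1\cdots a_k)^n)$ for all $n$. A $C^*$-probability space is a unital $C^*$-algebra with a positive unital linear functional $\tau$. *)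

(* Defs.v *)
(* MathComp / MathComp-Analysis *)
From HB Require Import structures.
From mathcomp Require Import all_boot all_order all_algebra.
From mathcomp Require Import all_classical all_reals all_analysis.
From mathcomp Require Import complex.

Set Implicit Arguments.
Unset Strict Implicit.
Unset Printing Implicit Defensive.

Import Order.TTheory GRing.Theory Num.Theory numFieldNormedType.Exports.

Local Open Scope classical_set_scope.
Local Open Scope ring_scope.
Local Open Scope complex_scope.

(* The norm is a field, not a normedModType instance: HB rejects a join of the
   ring and normed hierarchies declared after numDomainType. The algebra is
   nontrivial, which costs nothing here since a state has tau 1 = 1. *)
HB.mixin Record isCStarAlgebra (R : realType) A of GRing.Algebra R[i] A := {
  cnorm : A -> R ;
  star : A -> A ;
  cnorm_eq0 : forall x : A, cnorm x = 0 -> x = 0 ;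
  ler_cnormD : forall x y : A, cnorm (x + y) <= cnorm x + cnorm y ;
  cnormZ : forall (c : R[i]) (x : A), (cnorm (c *: x))%:C = `|c| * (cnorm x)%:C ;
  ler_cnormM : forall x y : A, cnorm (x * y) <= cnorm x * cnorm y ;
  cnorm_complete : forall u : nat -> A,
    (forall e : R, 0 < e -> exists N : nat, forall m n : nat,
      (N <= m)%N -> (N <= n)%N -> cnorm (u m - u n) < e) ->
    exists l : A, (fun n => cnorm (u n - l)) @ \oo --> (0 : R) ;
  starD : forall x y : A, star (x + y) = star x + star y ;
  starZ : forall (c : R[i]) (x : A), star (c *: x) = c^* *: star x ;
  starM : forall x y : A, star (x * y) = star y * star x ;
  starK : involutive star ;
  cnorm_starM : forall x : A, cnorm (star x * x) = cnorm x ^+ 2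
}.

#[short(type="cstarAlgType")]
HB.structure Definition CStarAlgebra (R : realType) :=
  { A of isCStarAlgebra R A & GRing.Algebra R[i] A }.

Section CStarProbability.
Context {R : realType} {A : cstarAlgType R}.

Definition cstar_positive (x : A) : Prop := exists y : A, x = star y * y.

Definition tracial_state (tau : {scalar A}) : Prop :=
  [/\ tau 1 = 1,
      forall x : A, 0 <= tau (star x * x) &
      forall x y : A, tau (x * y) = tau (y * x)].

Definition star_subalgebra (B : set A) : Prop :=
  [/\ B 1,
      forall (c : R[i]) x y, B x -> B y -> B (c *: x + y),
      forall x y, B x -> B y -> B (x * y) &
      forall x, B x -> B (star x)].

Definition generated_star_subalgebra (X : set A) : set A :=
  smallest star_subalgebra X.

(* Alternating products x_0 x_1 ... x_n have at least one factor: the empty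
   product is 1, on which a state takes the value 1. *)
Definition free_subalgebras (tau : A -> R[i]) (I : Type) (B : I -> set A) :
    Prop :=
  forall (n : nat) (i : nat -> I) (x : nat -> A),
    (forall j, (j < n)%N -> i j <> i j.+1) ->
    (forall j, (j <= n)%N -> B (i j) (x j)) ->
    (forall j, (j <= n)%N -> tau (x j) = 0) ->
    tau (\prod_(0 <= j < n.+1) x j) = 0.

Definition free_elements (tau : A -> R[i]) (I : Type) (a : I -> A) : Prop :=
  free_subalgebras tau (fun i => generated_star_subalgebra [set a i]).

(* The finite part is meaningful: this is only used for compactly supported
   measures, whose moments are all finite. *)
Definition has_distribution (tau : A -> R[i]) (x : A)
    (mu : probability (measurableTypeR R) R) : Prop :=
  forall n : nat, tau (x ^+ n) = (fine 'E_mu[fun t : R => t ^+ n])%:C.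

End CStarProbability.

Definition msupport {R : realType} (mu : probability (measurableTypeR R) R) :
    set R :=
  [set x : R | forall U : set R, open U -> U x -> (0 < mu U)%E].

(* nu is mu_0 [x] ... [x] mu_(k-1), the free multiplicative convolution, a
   measure determined by the mu_i: it is the distribution of
   b_0 ... b_(k-1) b_(k-1) ... b_0 with b_i the positive square root of a_i. *)
Definition is_free_mult_conv {R : realType} (k : nat)
    (mu : 'I_k -> probability (measurableTypeR R) R)
    (nu : probability (measurableTypeR R) R) : Prop :=
  [/\ compact (msupport nu), msupport nu `<=` `[0, +oo[ &
      exists (A : cstarAlgType R) (tau : {scalar A}) (a b : 'I_k -> A),
        [/\ tracial_state tau,
            free_elements tau a,
            forall i, cstar_positive (a i) /\ has_distribution tau (a i) (mu i),
            forall i, cstar_positive (b i) /\ b i ^+ 2 = a i &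
            has_distribution tau
              ((\prod_(i < k) b i) * (\prod_(i < k) b (rev_ord i))) nu]].

(* Main.v *)
Require Import Defs.
From HB Require Import structures.
From mathcomp Require Import all_boot all_order all_algebra.
From mathcomp Require Import all_classical all_reals all_analysis.
From mathcomp Require Import measurable_realfun complex ring lra.

Import Order.TTheory GRing.Theory Num.Theory numFieldNormedType.Exports.

Local Open Scope classical_set_scope.
Local Open Scope ring_scope.

Set Implicit Arguments.
Unset Strict Implicit.
Unset Printing Implicit Defensive.

(** Let [x = b_1 ... b_k b_k ... b_1], whose distribution is the free
    convolution [nu], and let [m_n] be its moments.

    The two bounds rest on the multiplicativity of the S-transform, used for formal
    power series. For an element [a] with [tau a = 1], let [s] be the series such
    that [Z * s] inverts the moment series, that is
    [\sum_n tau (a ^ n) (Z s) ^ n = 1 + Z]. If [a] and [x] are free with series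
    [s] and [t], the series of [a * x] is [(1 + Z) * s * t]
    ([momser_free_mul]). The proof computes the resolvent of [a * x] from those of
    [a] and [x], with coefficients in the algebra: after centering, all terms but
    one are alternating words, which freeness kills. By induction this gives the
    series of the whole product [x] ([momser_pal]).

    Lower bound. The coefficients of order one show that [m_2 - 1] is the sum of
    the variances ([pal_moments]). As [nu] lives on [0, L_k] and has mean [1],
    [m_2 <= L_k].

    Upper bound. By Lagrange inversion ([lagrange]), [n m_n] is the coefficient of
    order [n.-1] of [h ^ n], where [h] is the inverse of the series of [x]. Up to
    powers of [1 + Z], [h] is the product of the inverses of the series of the
    [a_i]; at radius [r = 1 / (6 L k)] each of these has weighted l1 norm at most
    [1 + O (1 / k)] ([momser_inverse]), so the product of all of them is bounded
    by a universal constant. Hence [m_n <= (36 L k) ^ n] ([pal_bound]), and the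
    support of [nu] lies in [0, 36 L k] ([msupport_ub]).

    There remains that freeness is given for the algebras generated by the [a_i],
    while [x] involves their square roots [b_i]. The positivity of [b_i] and the
    fact that the distribution of [a_i] lives on [0, L] imply that the
    polynomials in [b_i] are limits in the L2 norm of polynomials in [a_i]
    ([even_dense], [poly_alg_closure]). Since [tau] is a trace, such limits can be
    taken letter by letter in an alternating word, so that the algebras generated by
    the [b_i] are free as well ([free_L2closure]). *)

(** * Formal power series over a ring *)

Record fps (A : nzRingType) := Fps { fpsn : nat -> A }.
Coercion fpsn : fps >-> Funclass.

Lemma fpsP (A : nzRingType) (f g : fps A) : (forall n, f n = g n) -> f = g.
Proof. by case: f => f; case: g => g /= /funext ->. Qed.

HB.instance Definition _ (A : nzRingType) := gen_eqMixin (fps A).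
HB.instance Definition _ (A : nzRingType) := gen_choiceMixin (fps A).

Section FpsRing.
Context {A : nzRingType}.
Implicit Types f g h : fps A.

Definition fps_add f g := Fps (fun n => f n + g n).
Definition fps_opp f := Fps (fun n => - f n).
Definition fps_zero : fps A := Fps (fun=> 0).
Definition fps_one : fps A := Fps (fun n => (n == 0)%:R).
Definition fps_mul f g := Fps (fun n => \sum_(i < n.+1) f i * g (n - i)%N).
Local Notation add := fps_add.
Local Notation opp := fps_opp.
Local Notation zero := fps_zero.
Local Notation one := fps_one.
Local Notation mul := fps_mul.

Fact fps_addA : associative add.
Proof. by move=> f g h; apply: fpsP => n; rewrite /= addrA. Qed.
Fact fps_addC : commutative add.
Proof. by move=> f g; apply: fpsP => n; rewrite /= addrC. Qed.
Fact fps_add0 : left_id zero add.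
Proof. by move=> f; apply: fpsP => n; rewrite /= add0r. Qed.
Fact fps_addN : left_inverse zero opp add.
Proof. by move=> f; apply: fpsP => n; rewrite /= addNr. Qed.

HB.instance Definition _ :=
  GRing.isZmodule.Build (fps A) fps_addA fps_addC fps_add0 fps_addN.

(** Below a given order the product of series is a product of polynomials,
    from which associativity is inherited. *)
Let trunc (N : nat) f : {poly A} := \poly_(i < N.+1) f i.

Let mul_trunc N f g n : (n <= N)%N -> mul f g n = (trunc N f * trunc N g)`_n.
Proof.
move=> nN; rewrite coefM /=; apply: eq_bigr => i _; rewrite !coef_poly !ltnS.
by rewrite (leq_trans _ nN) -1?ltnS // (leq_ltn_trans (leq_subr _ _) (leq_ltn_trans nN _)).
Qed.

Fact fps_mulA : associative mul.
Proof.
move=> f g h; apply: fpsP => n; pose p := trunc n.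
transitivity ((p f * (p g * p h))`_n); last rewrite mulrA.
  rewrite coefM /=; apply: eq_bigr => i _.
  rewrite -(mul_trunc _ _ (leq_subr _ _)) coef_poly ltn_ord //.
rewrite [RHS]/(mul (mul f g) h n) coefM; apply: eq_bigr => i _.
by rewrite -mul_trunc -1?ltnS // coef_poly ltnS leq_subr.
Qed.

Fact fps_mul1 : left_id one mul.
Proof.
move=> f; apply: fpsP => n /=; rewrite big_ord_recl /= mul1r subn0.
by rewrite big1 ?addr0 // => i _; rewrite mul0r.
Qed.

Fact fps_mulr1 : right_id one mul.
Proof.
move=> f; apply: fpsP => n /=; rewrite big_ord_recr /= subnn mulr1.
rewrite big1 ?add0r // => i _; rewrite subn_eq0 leqNgt ltn_ord mulr0 //.
Qed.

Fact fps_mulDl : left_distributive mul +%R.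
Proof.
move=> f g h; apply: fpsP => n /=; rewrite -big_split /=.
by apply: eq_bigr => i _; rewrite mulrDl.
Qed.

Fact fps_mulDr : right_distributive mul +%R.
Proof.
move=> f g h; apply: fpsP => n /=; rewrite -big_split /=.
by apply: eq_bigr => i _; rewrite mulrDr.
Qed.

Fact fps_oner_neq0 : one != 0 :> fps A.
Proof.
apply/eqP => /(congr1 (fun f : fps A => f 0)) /= /eqP.
by rewrite oner_eq0.
Qed.

HB.instance Definition _ := GRing.Zmodule_isNzRing.Build (fps A)
  fps_mulA fps_mul1 fps_mulr1 fps_mulDl fps_mulDr fps_oner_neq0.

(** The formal variable. *)
Definition fpsZ : fps A := Fps (fun n => (n == 1)%:R).

Definition fpsC (c : A) : fps A := Fps (fun n => if n is 0 then c else 0).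

Lemma fpsZE n : fpsZ n = (n == 1)%:R. Proof. by []. Qed.
Lemma fpsCE c n : fpsC c n = if n is 0 then c else 0. Proof. by []. Qed.
Lemma fps0 n : (0 : fps A) n = 0. Proof. by []. Qed.
Lemma fps1 n : (1 : fps A) n = (n == 0)%:R. Proof. by []. Qed.
Lemma fpsD f g n : (f + g) n = f n + g n. Proof. by []. Qed.
Lemma fpsN f n : (- f) n = - f n. Proof. by []. Qed.
Lemma fpsM f g n : (f * g) n = \sum_(i < n.+1) f i * g (n - i)%N.
Proof. by []. Qed.

(* The operations are only used through their coefficients. *)
#[global] Opaque fps_add fps_opp fps_zero fps_one fps_mul fpsZ fpsC.

Lemma fps_sum (I : Type) (r : seq I) (P : pred I) (F : I -> fps A) n :
  (\sum_(i <- r | P i) F i) n = \sum_(i <- r | P i) F i n.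
Proof. by apply: (big_morph (fun f : fps A => f n)) => [f g|]; rewrite ?fpsD ?fps0. Qed.

Lemma fpsM0 f g : (f * g) 0 = f 0 * g 0.
Proof. by rewrite fpsM big_ord1. Qed.

Lemma fpsX0 f n : (f ^+ n) 0 = f 0 ^+ n.
Proof. by elim: n => [|n IH]; rewrite ?exprS ?fpsM0 ?IH. Qed.

Lemma fpsZM f n : (fpsZ * f) n = if n is m.+1 then f m else 0.
Proof.
rewrite fpsM; case: n => [|n]; first by rewrite big_ord1 fpsZE mul0r.
rewrite big_ord_recl fpsZE mul0r add0r big_ord_recl fpsZE mul1r subSS subn0.
by rewrite big1 ?addr0 // => i _; rewrite fpsZE mul0r.
Qed.

Lemma fpsMZ f : f * fpsZ = fpsZ * f.
Proof.
apply: fpsP => n; rewrite fpsZM fpsM; case: n => [|n].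
  by rewrite big_ord1 fpsZE mulr0.
rewrite big_ord_recr big_ord_recr /= subnn !fpsZE mulr0 addr0 subSnn mulr1.
rewrite big1 ?add0r // => i _; rewrite subSn -1?ltnS; last exact/leqW.
by rewrite fpsZE eqSS subn_eq0 leqNgt ltn_ord mulr0.
Qed.

Lemma fpsZX_comm m f : fpsZ ^+ m * f = f * fpsZ ^+ m.
Proof. by apply/esym/commrX/fpsMZ. Qed.

Lemma fpsZXM m f n : (fpsZ ^+ m * f) n = if (m <= n)%N then f (n - m)%N else 0.
Proof.
elim: m n => [|m IH] n; first by rewrite mul1r subn0.
by rewrite exprS -mulrA fpsZM; case: n => [|n]; rewrite ?IH.
Qed.

Lemma eq_fpsM_r f g h n : (forall i, (i <= n)%N -> g i = h i) ->
  (f * g) n = (f * h) n.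
Proof. by move=> gh; rewrite !fpsM; apply: eq_bigr => i _; rewrite gh ?leq_subr. Qed.

Lemma eq_fpsM_l f g h n : (forall i, (i <= n)%N -> g i = h i) ->
  (g * f) n = (h * f) n.
Proof. by move=> gh; rewrite !fpsM; apply: eq_bigr => i _; rewrite gh -1?ltnS. Qed.

(** [fpsum u] is the infinite sum of the [Z ^+ n * u n], which converges
    coefficientwise whatever the series [u n] are. *)
Definition fpsum (u : nat -> fps A) : fps A :=
  Fps (fun N => (\sum_(n < N.+1) fpsZ ^+ n * u n) N).

Lemma fpsum_coef u N : fpsum u N = \sum_(n < N.+1) u n (N - n)%N.
Proof.
by rewrite /= fps_sum; apply: eq_bigr => i _; rewrite fpsZXM -ltnS ltn_ord.
Qed.

Lemma fpsum_trunc u M N : (N < M)%N ->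
  fpsum u N = (\sum_(n < M) fpsZ ^+ n * u n) N.
Proof.
move=> NM /=; rewrite -(subnKC NM) big_split_ord fpsD [X in _ = _ + X]fps_sum.
rewrite [X in _ = _ + X]big1 ?addr0 // => i _.
by rewrite fpsZXM /= leqNgt ltnS leq_addr.
Qed.

Lemma eq_fpsum u v : u =1 v -> fpsum u = fpsum v.
Proof. by move=> /funext ->. Qed.

Lemma fpsum_recl u : fpsum u = u 0 + fpsZ * fpsum (fun n => u n.+1).
Proof.
apply: fpsP => -[|N]; rewrite fpsD fpsZM.
  by rewrite fpsum_coef big_ord1 addr0.
rewrite !fpsum_coef big_ord_recl subn0; congr (_ + _).
Qed.

Lemma mul_fpsum f u : f * fpsum u = fpsum (fun n => f * u n).
Proof.
apply: fpsP => N.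
rewrite (@eq_fpsM_r f _ (\sum_(n < N.+1) fpsZ ^+ n * u n)); last first.
  by move=> i iN; rewrite (@fpsum_trunc _ N.+1).
rewrite mulr_sumr (fpsum_trunc _ (ltnSn N)); congr (fpsn _ N).
by apply: eq_bigr => i _; rewrite !mulrA fpsZX_comm.
Qed.

Lemma fpsum_mul f u : fpsum u * f = fpsum (fun n => u n * f).
Proof.
apply: fpsP => N.
rewrite (@eq_fpsM_l f _ (\sum_(n < N.+1) fpsZ ^+ n * u n)); last first.
  by move=> i iN; rewrite (@fpsum_trunc _ N.+1).
rewrite mulr_suml (fpsum_trunc _ (ltnSn N)); congr (fpsn _ N).
by apply: eq_bigr => i _; rewrite -mulrA.
Qed.

#[global] Opaque fpsum.

(** The inverse of [1 - Z * f], as a geometric series. *)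
Definition geo f : fps A := fpsum (fun n => f ^+ n).

Lemma geoEl f : geo f = 1 + fpsZ * (f * geo f).
Proof.
rewrite /geo mul_fpsum {1}fpsum_recl; congr (_ + _ * _).
by apply: eq_fpsum => n; rewrite exprS.
Qed.

Lemma geoEr f : geo f = 1 + fpsZ * (geo f * f).
Proof.
rewrite /geo fpsum_mul {1}fpsum_recl; congr (_ + _ * _).
by apply: eq_fpsum => n; rewrite exprSr.
Qed.

Lemma geo_invr f : (1 - fpsZ * f) * geo f = 1.
Proof. by rewrite mulrBl mul1r {1}geoEl -mulrA addrK. Qed.

Lemma geo_invl f : geo f * (1 - fpsZ * f) = 1.
Proof. by rewrite mulrBr mulr1 [geo f * (_ * _)]mulrA fpsMZ -mulrA {1}geoEr addrK. Qed.

(** Such maps are contractions for the Z-adic distance: the coefficients of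
    order [n] of the iterates are constant from rank [n.+1] on. This solves
    implicit equations between series. *)
Lemma fps_fixpoint (Phi : fps A -> fps A) :
  (forall f g n, (forall i, (i < n)%N -> f i = g i) -> Phi f n = Phi g n) ->
  exists f, Phi f = f.
Proof.
move=> causal; pose F n := iter n Phi 0.
have FE m n i : (i < m)%N -> (i < n)%N -> F m i = F n i.
  elim: m n i => // m IH [|n] i //; rewrite !ltnS => im inn.
  by apply: causal => j ji; apply: IH; apply: leq_trans ji _.
exists (Fps (fun n => F n.+1 n)); apply: fpsP => n.
by apply: causal => i i_n; apply: (FE i.+1 n).
Qed.

End FpsRing.
Arguments fpsZ {A}.
Arguments fpsC {A}.

Lemma fpsMC (K : comNzRingType) : commutative (@GRing.mul (fps K)).
Proof.
move=> f g; apply: fpsP => n; rewrite !fpsM (reindex_inj rev_ord_inj) /=.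
by apply: eq_bigr => i _; rewrite mulrC subSS subKn // -ltnS.
Qed.

HB.instance Definition _ (K : comNzRingType) :=
  GRing.PzRing_hasCommutativeMul.Build (fps K) (@fpsMC K).

Section FpsConst.
Context {A : nzRingType}.
Implicit Types f g : fps A.

Lemma fpsCM c f n : (fpsC c * f) n = c * f n.
Proof.
by rewrite fpsM big_ord_recl subn0 big1 ?addr0 // => i _; rewrite fpsCE mul0r.
Qed.

Lemma fpsC1 : fpsC (1 : A) = 1.
Proof. by apply: fpsP => -[|n]; rewrite fpsCE fps1. Qed.

Definition agree N f g := forall i, (i < N)%N -> f i = g i.

Lemma agreeM N f f' g g' : agree N f f' -> agree N g g' ->
  agree N (f * g) (f' * g').
Proof.
move=> ff gg i iN; rewrite (@eq_fpsM_r _ f g g').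
  by apply: eq_fpsM_l => j ji; apply: ff; apply: leq_ltn_trans ji iN.
by move=> j ji; apply: gg; apply: leq_ltn_trans ji iN.
Qed.

Lemma agreeX N f f' n : agree N f f' -> agree N (f ^+ n) (f' ^+ n).
Proof.
move=> ff; elim: n => [|n IH]; first by move=> i.
by rewrite !exprS; apply: agreeM.
Qed.

Lemma agree_fpsum N u v : (forall n, agree N (u n) (v n)) ->
  agree N (fpsum u) (fpsum v).
Proof.
move=> uv i iN; rewrite !fpsum_coef; apply: eq_bigr => j _.
by apply: uv; apply: leq_ltn_trans (leq_subr _ _) iN.
Qed.

Lemma agree_sub1Z f g n : agree n f g -> (1 - fpsZ * f) n = (1 - fpsZ * g) n.
Proof.
move=> fg; rewrite 2!fpsD 2!fpsN 2!fpsZM.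
by case: n fg => // n fg; rewrite fg.
Qed.

(** The generating series of [m] evaluated at [Z * s], that is
    [\sum_n m_n (Z s) ^ n]. Factoring [Z] out of the argument makes every
    [s] admissible. If [m] is a moment sequence and [momser m s = 1 + Z], then
    [(1 + Z) * s] is the S-transform of the underlying measure. *)
Definition momser (m : nat -> A) (s : fps A) : fps A :=
  fpsum (fun n => fpsC (m n) * s ^+ n).

Lemma agree_momser N m f g : agree N f g -> agree N (momser m f) (momser m g).
Proof.
move=> fg; apply: agree_fpsum => n; apply: agreeM; first by move=> i.
exact: agreeX fg.
Qed.

End FpsConst.

Lemma momser_recl (K : comNzRingType) (m : nat -> K) (s : fps K) :
  momser m s = fpsC (m 0%N) + fpsZ * (s * momser (fun n => m n.+1) s).
Proof.
rewrite /momser fpsum_recl mulr1 (mul_fpsum s); congr (_ + _ * _).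
by apply: eq_fpsum => n; rewrite exprS mulrCA.
Qed.

Lemma momser_trunc (A : nzRingType) (m : nat -> A) s M N : (N < M)%N ->
  momser m s N = (\sum_(n < M) fpsZ ^+ n * (fpsC (m n) * s ^+ n)) N.
Proof. exact: fpsum_trunc. Qed.

Lemma momser_coef (A : nzRingType) (m : nat -> A) s N :
  momser m s N = \sum_(n < N.+1) m n * (s ^+ n) (N - n)%N.
Proof. by rewrite /momser fpsum_coef; apply: eq_bigr => n _; rewrite fpsCM. Qed.

#[global] Opaque momser.

Lemma geometric_sum_le (K : numFieldType) (u : K) N :
  0 <= u < 1 -> \sum_(n < N) u ^+ n <= (1 - u)^-1.
Proof.
move=> /andP[u0 u1]; have u1' : 0 < 1 - u by rewrite subr_gt0.
rewrite -[leRHS]mul1r ler_pdivlMr // mulrC -opprB mulNr -subrX1 opprB.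
by rewrite lerBlDr lerDl exprn_ge0.
Qed.

(** * Weighted norms and local inversion of moment series *)

Section FpsNorm.
Context {K : numFieldType}.
Variable r : K.
Hypothesis r0 : 0 <= r.
Implicit Types f g : fps K.

(** The l1 norm at radius [r] of the truncation at order [N]. Truncating keeps
    all sums finite; as for the full norm, submultiplicativity makes bounds on
    products and inverses immediate. *)
Definition fnorm N f := \sum_(i < N) `|f i| * r ^+ i.

Lemma fnorm_ge0 N f : 0 <= fnorm N f.
Proof. by apply: sumr_ge0 => i _; rewrite mulr_ge0 ?exprn_ge0. Qed.

Lemma fnorm_coef n f : `|f n| * r ^+ n <= fnorm n.+1 f.
Proof. by rewrite /fnorm big_ord_recr /= lerDr -/(fnorm n f) fnorm_ge0. Qed.

Lemma fnormD N f g : fnorm N (f + g) <= fnorm N f + fnorm N g.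
Proof.
rewrite -big_split; apply: ler_sum => i _ /=.
by rewrite -mulrDl ler_wpM2r ?exprn_ge0 // ler_normD.
Qed.

Lemma fnormN N f : fnorm N (- f) = fnorm N f.
Proof. by apply: eq_bigr => i _; rewrite fpsN normrN. Qed.

Lemma fnorm_le M N f : (M <= N)%N -> fnorm M f <= fnorm N f.
Proof.
move=> MN; rewrite /fnorm -(subnKC MN) big_split_ord /= lerDl.
by apply: sumr_ge0 => i _; rewrite mulr_ge0 ?exprn_ge0.
Qed.

Lemma fnormM N f g : fnorm N (f * g) <= fnorm N f * fnorm N g.
Proof.
pose a i := `|f i| * r ^+ i; pose b i := `|g i| * r ^+ i.
pose S m := \sum_(j < m) b j.
have a0 i : 0 <= a i by rewrite mulr_ge0 ?exprn_ge0.
have conv M : \sum_(n < M) \sum_(i < n.+1) a i * b (n - i)%N =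
              \sum_(i < M) a i * S (M - i)%N.
  elim: M => [|M IH]; first by rewrite !big_ord0.
  rewrite big_ord_recr {}IH /= [in RHS]big_ord_recr /= subSnn.
  rewrite [X in _ + X]big_ord_recr /= subnn addrA; congr (_ + _).
    rewrite -big_split /=; apply: eq_bigr => i _.
    by rewrite -mulrDr subSn ?[S _.+1]big_ord_recr // ltnW.
  by rewrite /S big_ord1.
have -> : fnorm N f * fnorm N g = \sum_(i < N) a i * S N by rewrite mulr_suml.
apply: (@le_trans _ _ (\sum_(n < N) \sum_(i < n.+1) a i * b (n - i)%N)).
  apply: ler_sum => n _; rewrite fpsM.
  apply: le_trans (ler_wpM2r _ (ler_norm_sum _ _ _)) _; first exact: exprn_ge0.
  rewrite mulr_suml; apply: ler_sum => i _.
  by rewrite normrM /a /b mulrACA -exprD subnKC // -ltnS.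
rewrite conv; apply: ler_sum => i _; apply: ler_wpM2l => //.
exact: (fnorm_le g (leq_subr i N)).
Qed.

Lemma fnorm1 N : fnorm N 1 <= 1.
Proof.
case: N => [|N]; first by rewrite /fnorm big_ord0 ler01.
rewrite /fnorm big_ord_recl fps1 normr1 mulr1 big1 ?addr0 // => i _.
by rewrite fps1 normr0 mul0r.
Qed.

Lemma fnormX N f n : fnorm N (f ^+ n) <= fnorm N f ^+ n.
Proof.
elim: n => [|n IH]; first exact: fnorm1.
rewrite !exprS; apply: le_trans (fnormM _ _ _) _.
by rewrite ler_wpM2l ?fnorm_ge0.
Qed.

Lemma fnormC N c f : fnorm N (fpsC c * f) = `|c| * fnorm N f.
Proof.
by rewrite mulr_sumr; apply: eq_bigr => i _; rewrite fpsCM normrM mulrA.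
Qed.

Lemma fnormZM N f : fnorm N.+1 (fpsZ * f) = r * fnorm N f.
Proof.
rewrite /fnorm big_ord_recl fpsZM normr0 mul0r add0r mulr_sumr.
by apply: eq_bigr => i _; rewrite fpsZM exprS mulrCA.
Qed.

Lemma fnormZXM N n f : fnorm N (fpsZ ^+ n * f) <= r ^+ n * fnorm N f.
Proof.
elim: n => [|n IH]; first by rewrite !mul1r.
rewrite !exprS -!mulrA; case: N IH => [|N] IH.
  by rewrite /fnorm !big_ord0 !mulr0.
rewrite fnormZM ler_wpM2l //; apply: le_trans IH.
exact: fnorm_le.
Qed.

Lemma fnorm_fpsum N u :
  fnorm N (fpsum u) <= \sum_(n < N) r ^+ n * fnorm N (u n).
Proof.
have -> : fnorm N (fpsum u) = fnorm N (\sum_(n < N) fpsZ ^+ n * u n).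
  by apply: eq_bigr => i _; rewrite (fpsum_trunc u (ltn_ord i)).
elim/big_ind2: _ => [|f x g y fx gy|n _].
- by rewrite /fnorm big1 // => i _; rewrite fps0 normr0 mul0r.
- exact: le_trans (fnormD _ _ _) (lerD fx gy).
- exact: fnormZXM.
Qed.

Lemma fnorm_momser N (m : nat -> K) s (a b : K) : 0 <= b -> r * b < 1 ->
  0 <= a -> (forall n, `|m n| * fnorm N s ^+ n <= a * b ^+ n) ->
  fnorm N (momser m s) <= a / (1 - r * b).
Proof.
move=> b0 rb1 a0 mb; have rb : 0 <= r * b < 1 by rewrite mulr_ge0.
apply: le_trans (fnorm_fpsum _ _) _.
apply: (@le_trans _ _ (a * \sum_(n < N) (r * b) ^+ n)); last first.
  by rewrite ler_wpM2l ?geometric_sum_le.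
rewrite mulr_sumr; apply: ler_sum => n _; rewrite exprMn mulrCA.
rewrite ler_wpM2l ?exprn_ge0 // fnormC; apply: le_trans (mb n).
by rewrite ler_wpM2l ?fnormX.
Qed.

End FpsNorm.

Section LocalInverse.
Context {K : numFieldType}.

(** The equation says that [Z * s] inverts [\sum_(n > 0) m_n X ^ n]. It amounts
    to [s = 1 - \sum_(n > 1) m_n Z ^ n.-1 s ^ n], whose right-hand side maps the
    ball of radius [2] into itself as soon as [6 L r <= 1]. The inverse of [s] is
    then explicit, [h = \sum_n m_n.+1 (Z s) ^ n], and close to [1] for small
    [L * r]. *)
Lemma momser_inverse (m : nat -> K) (L r : K) :
  m 0%N = 1 -> m 1%N = 1 -> (forall n, 0 <= m n.+1 <= L ^+ n) ->
  0 <= L -> 0 <= r -> 6%:R * L * r <= 1 ->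
  exists s h : fps K, [/\ momser m s = 1 + fpsZ, s * h = 1 &
    forall N, fnorm r N h <= (1 - 2%:R * L * r)^-1].
Proof.
move=> m0 m1 mL L0 r0 Lr.
pose tail := momser (fun n => m n.+2).
have [s sE] : exists s, 1 - fpsZ * (s * (s * tail s)) = s.
  apply: (@fps_fixpoint K (fun s => 1 - fpsZ * (s * (s * tail s)))) => f g n fg.
  apply: agree_sub1Z; apply: (agreeM fg); apply: (agreeM fg).
  exact: agree_momser.
pose h := momser (fun n => m n.+1) s.
have sh : s * h = 1.
  rewrite /h momser_recl m1 fpsC1 mulrDr mulr1 mulrCA -/(tail s).
  set x := fpsZ * _ in sE *; rewrite -[X in X + _]sE; exact: subrK.
exists s, h; split=> //; first by rewrite momser_recl m0 fpsC1 -/h sh mulr1.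
pose u := r * (L * 2%:R).
have uE : 2%:R * L * r = u by rewrite /u mulrC (mulrC L).
have b0 : 0 <= L * 2%:R by rewrite mulr_ge0.
have u0 : 0 <= u by rewrite mulr_ge0.
have u13 : 3%:R * u <= 1 by rewrite -uE !mulrA -natrM.
have u1 : u < 1.
  by rewrite -(@ltr_pM2l _ 3%:R) ?mulr1 ?ltr0n // (le_lt_trans u13) // ltr1n.
have bound N (a : K) p : 0 <= a -> fnorm r N s <= 2%:R ->
    (forall n, `|p n| <= a * L ^+ n) -> fnorm r N (momser p s) <= a / (1 - u).
  move=> a0 sN pL; apply: fnorm_momser => // n.
  rewrite exprMn mulrA ler_pM ?exprn_ge0 ?fnorm_ge0 //.
  by rewrite lerXn2r ?nnegrE ?fnorm_ge0.
have mN n : `|m n.+1| <= L ^+ n.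
  by have /andP[mn0 mn1] := mL n; rewrite ger0_norm.
(* The factor [Z] in the equation for [s] raises the order of truncation by one,
   hence the induction. *)
have s2 N : fnorm r N s <= 2%:R.
  elim: N => [|N IH]; first by rewrite /fnorm big_ord0.
  rewrite -sE; apply: le_trans (fnormD r0 _ _ _) _.
  rewrite fnormN fnormZM [2%:R](natrD _ 1 1) lerD ?fnorm1 //.
  have tb : fnorm r N (tail s) <= L / (1 - u).
    by apply: bound => // n; rewrite -exprS.
  apply: (@le_trans _ _ (r * (2%:R * (2%:R * (L / (1 - u)))))).
    rewrite ler_wpM2l //; apply: le_trans (fnormM r0 _ _ _) _.
    rewrite ler_pM ?fnorm_ge0 //; apply: le_trans (fnormM r0 _ _ _) _.
    by rewrite ler_pM ?fnorm_ge0.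
  have -> : r * (2%:R * (2%:R * (L / (1 - u)))) = 2%:R * u / (1 - u).
    by move: (_^-1) => v; rewrite /u; ring.
  rewrite ler_pdivrMr ?subr_gt0 // mul1r lerBrDr.
  by rewrite (_ : 2%:R * u + u = 3%:R * u) //; ring.
move=> N; rewrite uE -[leRHS]mul1r; apply: bound => // n.
by rewrite mul1r.
Qed.

End LocalInverse.

(** * Lagrange inversion *)

Section Lagrange.
Context {K : numFieldType}.
Implicit Types f g h : fps K.

(** The derivation [Z d/dZ]. *)
Definition theta f : fps K := Fps (fun n => f n *+ n).

Lemma thetaE f n : theta f n = f n *+ n. Proof. by []. Qed.

Lemma fpsMn f k n : (f *+ k) n = f n *+ k.
Proof. by elim: k => [|k IH]; rewrite ?mulr0n ?fps0 // !mulrS fpsD IH. Qed.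

#[local] Opaque theta.

Lemma thetaM f g : theta (f * g) = theta f * g + f * theta g.
Proof.
apply: fpsP => n; rewrite fpsD ![in RHS]fpsM -big_split /=.
rewrite thetaE fpsM -sumrMnl; apply: eq_bigr => i _; rewrite !thetaE.
by rewrite mulrnAl mulrnAr -mulrnDr subnKC // -ltnS.
Qed.

Lemma theta1 : theta 1 = 0.
Proof. by apply: fpsP => -[|n]; rewrite thetaE fps1 ?mulr0n ?mul0rn. Qed.

Lemma theta_sum (I : Type) (s : seq I) (F : I -> fps K) :
  theta (\sum_(i <- s) F i) = \sum_(i <- s) theta (F i).
Proof.
apply: (big_morph theta) => [f g|]; apply: fpsP => n.
  by rewrite fpsD !thetaE fpsD mulrnDl.
by rewrite thetaE mul0rn.
Qed.

Lemma thetaX f n : theta (f ^+ n) = f ^+ n.-1 * theta f *+ n.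
Proof.
elim: n => [|n IH]; first by rewrite theta1 mulr0n.
rewrite exprS thetaM IH; case: n {IH} => [|n].
  by rewrite mulr0n mulr0 mulr1 addr0 mul1r mulr1n.
by rewrite mulrnAr /= mulrA -exprS [theta f * _]mulrC -mulrS.
Qed.

Lemma thetaZX j f : theta (fpsZ ^+ j * f) = fpsZ ^+ j * (f *+ j + theta f).
Proof.
rewrite thetaM mulrDr; congr (_ + _).
have tZ : theta fpsZ = fpsZ.
  by apply: fpsP => -[|[|n]]; rewrite thetaE fpsZE ?mulr1n ?mulr0n ?mul0rn.
rewrite thetaX tZ mulrnAl -mulrnAr; case: j => [|j]; first by rewrite !mulr0n !mulr0.
by rewrite -exprSr.
Qed.

Lemma thetaC c f : theta (fpsC c * f) = fpsC c * theta f.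
Proof. by apply: fpsP => n; rewrite fpsCM !thetaE fpsCM mulrnAr. Qed.

(** Lagrange inversion. Applying [theta] to [\sum_j m_j (Z g) ^ j = 1 + Z] gives
    [\sum_j m_j theta ((Z g) ^ j) = Z]. Multiply by [h ^ n.+1] and read the
    coefficient of order [n.+1]: the term of index [j <= n] vanishes, as
    [theta ((Z g) ^ j) * h ^ n.+1] is a multiple of
    [Z ^ j * (e h ^ e - theta (h ^ e))] with [e = n.+1 - j], whose coefficient of
    order [j + e] is zero. *)
Lemma lagrange (m : nat -> K) g h n :
  momser m g = 1 + fpsZ -> g * h = 1 -> m n.+1 *+ n.+1 = (h ^+ n.+1) n.
Proof.
move=> mg gh; pose N := n.+1; rewrite -/N.
have ghX j : g ^+ j * h ^+ j = 1 by rewrite -exprMn gh expr1n.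
have -> : (h ^+ N) n = (theta (momser m g) * h ^+ N) N.
  rewrite mg; have -> : theta (1 + fpsZ) = fpsZ :> fps K.
    by apply: fpsP => -[|[|k]]; rewrite thetaE fpsD fps1 fpsZE ?add0r ?mulr0n ?mulr1n ?mul0rn.
  by rewrite fpsZM.
rewrite (@eq_fpsM_l _ _ _
  (theta (\sum_(j < N.+1) fpsZ ^+ j * (fpsC (m j) * g ^+ j)))); last first.
  by move=> i iN; rewrite !thetaE; congr (_ *+ i); apply: momser_trunc.
rewrite theta_sum mulr_suml fps_sum big_ord_recr /=.
rewrite big1 ?add0r => [|[j jN'] _ /=].
  rewrite thetaZX thetaC -mulrnAr -mulrDr -!mulrA fpsZXM leqnn subnn fpsCM.
  rewrite fpsM0 fpsD mulrDl.
  have -> : (theta (g ^+ N)) 0 = 0 by rewrite thetaE mulr0n.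
  by rewrite fpsMn mul0r addr0 mulrnAl -fpsM0 ghX fps1 mulrnAr mulr1.
have jN : (j <= n)%N by [].
set e := (n - j)%N.
have NE : N = (j + e.+1)%N by rewrite addnS subnKC.
rewrite thetaZX thetaC -mulrnAr -mulrDr -!mulrA fpsZXM (leq_trans jN) // fpsCM {jN'}.
have -> : (N - j = e.+1)%N by rewrite NE addKn.
suff : (((g ^+ j *+ j + theta (g ^+ j)) * h ^+ N) *+ e.+1) e.+1 = 0 :> K.
  by rewrite fpsMn; move/eqP; rewrite mulrn_eq0 /= => /eqP ->; rewrite mulr0.
have gjh : g ^+ j * h ^+ N = h ^+ e.+1.
  by rewrite NE exprD mulrA ghX mul1r.
have dg : theta (g ^+ j) * h ^+ N *+ e.+1 = - (theta (h ^+ e.+1) *+ j).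
  have t0 : theta (g ^+ j) * h ^+ j = - (g ^+ j * theta (h ^+ j)).
    by apply/eqP; rewrite -addr_eq0 -thetaM ghX theta1.
  rewrite NE exprD mulrA t0; case: (j : nat) {NE gjh t0} => [|i].
    by rewrite !expr0 theta1 mulr0 oppr0 mul0r mul0rn.
  rewrite !thetaX mulrnAr mulNr mulrnAl mulNrn.
  congr (- _); rewrite -!mulrnA mulnC; congr (_ *+ _) => /=.
  have regroup (a b c d : fps K) :
    a * g * (b * c) * (h * d) = a * b * (g * h) * (d * c) by ring.
  by rewrite exprSr (exprS h e) regroup ghX gh !mul1r.
rewrite mulrDl mulrnAl gjh mulrnDl dg -mulrnA mulnC mulrnA -mulrnBl fpsMn.
by rewrite fpsD fpsN thetaE fpsMn subrr mul0rn.
Qed.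

Lemma lagrange_bound (m : nat -> K) g h (r B : K) n :
  momser m g = 1 + fpsZ -> g * h = 1 -> 0 <= r -> 
  (forall N, fnorm r N h <= B) -> `|m n.+1| * r ^+ n <= B ^+ n.+1.
Proof.
move=> mg gh r0 hB.
apply: (@le_trans _ _ (`|(h ^+ n.+1) n| * r ^+ n)).
  rewrite -(lagrange _ mg gh) ler_wpM2r ?exprn_ge0 // normrMn.
  by rewrite -[leLHS]mulr1n ler_wpMn2l.
apply: le_trans (fnorm_coef r0 _ _) _; apply: le_trans (fnormX r0 _ _ _) _.
by rewrite lerXn2r ?nnegrE ?fnorm_ge0 ?(le_trans (fnorm_ge0 r0 0 h) (hB 0)).
Qed.

End Lagrange.

(** * Free products of algebras and alternating words *)

Section Free.
Context {K : numFieldType} {A : algType K} (I : eqType) (tau : {scalar A}).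
Variable E : I -> set A.
Hypothesis tau1 : tau 1 = 1.
Hypothesis tauC : forall x y, tau (x * y) = tau (y * x).
Hypothesis E1 : forall i, E i 1.
Hypothesis ED : forall i c x y, E i x -> E i y -> E i (c *: x + y).
Hypothesis EM : forall i x y, E i x -> E i y -> E i (x * y).

Definition wprod (w : seq (I * A)) : A := \prod_(t <- w) t.2.

Definition centered_word (w : seq (I * A)) : Prop :=
  sorted (fun s t : I * A => s.1 != t.1) w /\
  (forall t, t \in w -> E t.1 t.2 /\ tau t.2 = 0).

Hypothesis E_free : forall w, w <> [::] -> centered_word w -> tau (wprod w) = 0.

(** The span of the alternating centered words with letters in [E i], [i] in
    [J], whose first letter is in some [E i] with [i] in [F] and whose last letter
    is in some [E i] with [i] in [G]. Both ends are recorded because a product of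
    two words alternates as soon as the end of the first one and the beginning of
    the second one avoid each other. *)
Inductive altspan (J G : set I) : set I -> A -> Prop :=
| Alt0 (F : set I) : altspan J G F 0
| AltD (F : set I) c x y :
    altspan J G F x -> altspan J G F y -> altspan J G F (c *: x + y)
| AltLetter (F : set I) i x :
    J i -> F i -> G i -> E i x -> tau x = 0 -> altspan J G F x
| AltM (F : set I) i x y : J i -> F i -> E i x -> tau x = 0 ->
    altspan J G [set j | j != i] y -> altspan J G F (x * y).

Lemma E_center i x : E i x -> E i (x - (tau x)%:A).
Proof.
move=> Ex; rewrite -scaleNr addrC; apply: ED => //.
Qed.

Lemma tau_scale1 c : tau c%:A = c.
Proof. by rewrite linearZ /= tau1 mulr1. Qed.

Lemma tau_center x : tau (x - (tau x)%:A) = 0.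
Proof. by rewrite linearB /= tau_scale1 subrr. Qed.

Lemma altspanD J G F x y : altspan J G F x -> altspan J G F y ->
  altspan J G F (x + y).
Proof. by move=> xV yV; rewrite -[x]scale1r; apply: AltD. Qed.

Lemma altspanB J G F x y : altspan J G F x -> altspan J G F y ->
  altspan J G F (x - y).
Proof. by move=> xV yV; rewrite addrC -scaleN1r; apply: AltD. Qed.

Lemma altspan_sum J G F (T : Type) (r : seq T) (f : T -> A) :
  (forall i, altspan J G F (f i)) -> altspan J G F (\sum_(i <- r) f i).
Proof.
move=> fV; elim/big_ind: _ => //; first exact: Alt0.
exact: altspanD.
Qed.

Lemma sorted_rcons2 (T : Type) (e : rel T) w x y :
  sorted e (rcons (rcons w x) y) = sorted e (rcons w x) && e x y.
Proof.
by case: w => [|z w] /=; rewrite ?andbT // !rcons_path last_rcons.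
Qed.

(** Freeness for words extends to their span by expanding the last factor; the
    prefix [w] absorbs the letters already peeled off. *)
Lemma tau_word_altspan J G F y : altspan J G F y ->
  forall w, (forall i x, F i -> E i x -> tau x = 0 -> centered_word (rcons w (i, x))) ->
  tau (wprod w * y) = 0.
Proof.
elim=> {F y} [F|F c x y _ IHx _ IHy|F i x _ Fi _ Ex tx|F i x y _ Fi Ex tx _ IH] w wF.
- by rewrite mulr0 linear0.
- by rewrite mulrDr -scalerAr linearP /= IHx // IHy // mulr0 addr0.
- suff : tau (wprod (rcons w (i, x))) = 0.
    by rewrite /wprod -cats1 big_cat big_seq1.
  by apply: E_free; [case: (w) | exact: wF].
- rewrite mulrA; have -> : wprod w * x = wprod (rcons w (i, x)).
    by rewrite /wprod -cats1 big_cat big_seq1.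
  have [ws wE] := wF i x Fi Ex tx.
  apply: IH => j z ji Ez tz; split.
    by rewrite sorted_rcons2 ws /= eq_sym.
  by move=> t; rewrite mem_rcons inE => /orP[/eqP -> //|]; apply: wE.
Qed.

Lemma tau_altspan J G F y : altspan J G F y -> tau y = 0.
Proof.
move=> yV; have := tau_word_altspan yV (w := [::]).
rewrite /wprod big_nil mul1r; apply => i x _ Ex tx; split=> //= t.
by rewrite inE => /eqP ->.
Qed.

Lemma altspan_sub J J' G G' F F' y : J `<=` J' -> G `<=` G' -> F `<=` F' ->
  altspan J G F y -> altspan J' G' F' y.
Proof.
move=> JJ GG FF yV; elim: yV F' FF => {F y}
    [F|F c x y _ IHx _ IHy|F i x Ji Fi Gi Ex tx|F i x y Ji Fi Ex tx _ IH] F' FF.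
- exact: Alt0.
- by apply: AltD; [apply: IHx|apply: IHy].
- by apply: (@AltLetter _ _ _ i); [apply: JJ|apply: FF|apply: GG|..].
- by apply: (@AltM _ _ _ i); [apply: JJ|apply: FF|..|apply: IH].
Qed.

Lemma altspanM J G F G' F' x y : (forall i, G i -> F' i -> False) ->
  altspan J G F x -> altspan J G' F' y -> altspan J G' F (x * y).
Proof.
move=> GF xV; elim: xV y => {F x}
    [F|F c x z _ IHx _ IHz|F i x Ji Fi Gi Ex tx|F i x z Ji Fi Ex tx _ IH] y yV.
- by rewrite mul0r; apply: Alt0.
- by rewrite mulrDl -scalerAl; apply: AltD; [apply: IHx|apply: IHz].
- apply: (@AltM _ _ _ i) => //; apply: altspan_sub yV => // j F'j /=.
  by apply/eqP => ji; apply: (GF i) => //; rewrite -ji.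
- by rewrite -mulrA; apply: (@AltM _ _ _ i) => //; apply: IH.
Qed.

Lemma altspan_first J G F y : altspan J G F y -> altspan J G J y.
Proof.
elim=> {F y} [F|F c x y _ IHx _ IHy|F i x Ji Fi Gi Ex tx|F i x y Ji Fi Ex tx yV _].
- exact: Alt0.
- exact: AltD.
- exact: (@AltLetter _ _ _ i).
- exact: (@AltM _ _ _ i).
Qed.

(** The unital algebra generated by the [E j], [j] in [J]: by
    [const_alt_lmul] below it is stable by left multiplication by each of them. *)
Definition const_alt (J : set I) (x : A) : Prop :=
  exists c v, x = c%:A + v /\ altspan J J J v.

Lemma const_alt1 J : const_alt J 1.
Proof. by exists 1, 0; rewrite scale1r addr0; split=> //; apply: Alt0. Qed.

Lemma const_altD J c x y : const_alt J x -> const_alt J y ->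
  const_alt J (c *: x + y).
Proof.
move=> [a [u [-> uV]]] [b [v [-> vV]]]; exists (c * a + b), (c *: u + v).
split; last exact: AltD.
by rewrite scalerDr scalerA scalerDl -!addrA; congr (_ + _); rewrite addrCA.
Qed.

Lemma const_alt_letter J i x : J i -> E i x -> const_alt J x.
Proof.
move=> Ji Ex; exists (tau x), (x - (tau x)%:A); split.
  by rewrite addrC subrK.
by apply: (@AltLetter _ _ _ i) => //; [apply: E_center|apply: tau_center].
Qed.

Lemma const_alt_span J x : altspan J J J x -> const_alt J x.
Proof. by exists 0, x; rewrite scale0r add0r. Qed.

(** To multiply a word by [x] on the left, center either [x], or its product
    with the first letter when both come from the same algebra. *)
Lemma const_alt_lmul J i x y : J i -> E i x -> const_alt J y ->
  const_alt J (x * y).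
Proof.
move=> Ji Ex [c [v [-> vV]]].
rewrite mulrDr -scalerAr mulr1; apply: const_altD; first exact: const_alt_letter Ex.
suff : forall F v, altspan J J F v -> F `<=` J -> const_alt J (x * v).
  by move=> /(_ J v vV); apply.
move=> {c vV} F {}v; elim=> {F v}
    [F|F c v w _ IHv _ IHw|F j z Jj _ _ Ez tz|F j z v Jj _ Ez tz vV _] FJ.
- by rewrite mulr0; apply: const_alt_span; apply: Alt0.
- by rewrite mulrDr -scalerAr; apply: const_altD; [apply: IHv|apply: IHw].
- have [ij|ij] := eqVneq i j.
    by subst j; apply: (const_alt_letter Ji); apply: EM.
  have -> : x * z = tau x *: z + (x - (tau x)%:A) * z.
    by rewrite mulrBl -scalerAl mul1r addrC subrK.
  apply: const_altD; apply: const_alt_span.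
    exact: (@AltLetter _ _ _ j).
  apply: (@AltM _ _ _ i) => //; [exact: E_center|exact: tau_center|].
  by apply: (@AltLetter _ _ _ j) => //=; rewrite eq_sym.
- have [ij|ij] := eqVneq i j.
    subst j; rewrite mulrA.
    have -> : x * z * v = tau (x * z) *: v + (x * z - (tau (x * z))%:A) * v.
      by rewrite mulrBl -scalerAl mul1r addrC subrK.
    have xzE : E i (x * z) by apply: EM.
    apply: const_altD; apply: const_alt_span; first exact: altspan_first vV.
    apply: (@AltM _ _ _ i) => //; [exact: E_center|exact: tau_center].
  have -> : x * (z * v) = tau x *: (z * v) + (x - (tau x)%:A) * (z * v).
    by rewrite mulrBl -scalerAl mul1r addrC subrK.
  have zvV : altspan J J [set k | k != i] (z * v).
    by apply: (@AltM _ _ _ j) => //=; rewrite eq_sym.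
  apply: const_altD; apply: const_alt_span; first exact: altspan_first zvV.
  by apply: (@AltM _ _ _ i) => //; [exact: E_center|exact: tau_center].
Qed.

Lemma const_alt_centered J x : const_alt J x -> tau x = 0 -> altspan J J J x.
Proof.
move=> [c [v [-> vV]]]; rewrite linearD /= tau_scale1 (tau_altspan vV) addr0.
by move=> ->; rewrite scale0r add0r.
Qed.

(** * Resolvents and multiplicativity of the S-transform *)

Definition fps_scal (f : fps K) : fps A := Fps (fun n => (f n)%:A).
Definition fps_tau (f : fps A) : fps K := Fps (fun n => tau (f n)).

Lemma fps_scalE f n : fps_scal f n = (f n)%:A. Proof. by []. Qed.
Lemma fps_tauE f n : fps_tau f n = tau (f n). Proof. by []. Qed.

#[local] Opaque fps_scal fps_tau.

Lemma fps_scalD f g : fps_scal (f + g) = fps_scal f + fps_scal g.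
Proof. by apply: fpsP => n; rewrite fpsD !fps_scalE fpsD scalerDl. Qed.

Lemma fps_scal1 : fps_scal 1 = 1.
Proof. by apply: fpsP => n; rewrite fps_scalE !fps1; case: eqP; rewrite ?scale1r ?scale0r. Qed.

Lemma fps_scalZ : fps_scal fpsZ = fpsZ.
Proof. by apply: fpsP => n; rewrite fps_scalE !fpsZE; case: eqP; rewrite ?scale1r ?scale0r. Qed.

Lemma fps_scalM f g : fps_scal (f * g) = fps_scal f * fps_scal g.
Proof.
apply: fpsP => n; rewrite fps_scalE !fpsM scaler_suml; apply: eq_bigr => i _.
by rewrite !fps_scalE -scalerAl mul1r scalerA.
Qed.

Lemma fps_scalX f n : fps_scal (f ^+ n) = fps_scal f ^+ n.
Proof. by elim: n => [|n IH]; rewrite ?fps_scal1 // !exprS fps_scalM IH. Qed.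

Lemma fps_scalC f g : fps_scal f * g = g * fps_scal f.
Proof.
apply: fpsP => n; rewrite !fpsM [RHS](reindex_inj rev_ord_inj) /=.
apply: eq_bigr => i _; rewrite !fps_scalE subSS subKn -1?ltnS //.
by rewrite -scalerAl -scalerAr mul1r mulr1.
Qed.

Lemma fps_tauD f g : fps_tau (f + g) = fps_tau f + fps_tau g.
Proof. by apply: fpsP => n; rewrite fpsD !fps_tauE fpsD linearD. Qed.

Lemma fps_tau1 : fps_tau 1 = 1.
Proof. by apply: fpsP => n; rewrite fps_tauE !fps1; case: eqP; rewrite ?tau1 ?linear0. Qed.

Lemma fps_tau_scal f g : fps_tau (fps_scal f * g) = f * fps_tau g.
Proof.
apply: fpsP => n; rewrite fps_tauE !fpsM linear_sum; apply: eq_bigr => i _ /=.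
by rewrite fps_scalE fps_tauE -scalerAl mul1r linearZ.
Qed.

Lemma fps_tauZ g : fps_tau (fpsZ * g) = fpsZ * fps_tau g.
Proof. by rewrite -{1}fps_scalZ fps_tau_scal. Qed.

Lemma fps_tauC f g : fps_tau (f * g) = fps_tau (g * f).
Proof.
apply: fpsP => n; rewrite !fps_tauE !fpsM (reindex_inj rev_ord_inj) /= !linear_sum.
by apply: eq_bigr => i _; rewrite tauC subSS subKn -1?ltnS.
Qed.

(** The resolvent [(1 - Z s a)^-1]. *)
Definition resolvent (s : fps K) (a : A) : fps A := geo (fps_scal s * fpsC a).

Lemma fpsCX a n : fpsC a ^+ n = fpsC (a ^+ n) :> fps A.
Proof.
elim: n => [|n IH]; first by rewrite expr0 fpsC1.
by apply: fpsP => -[|k]; rewrite exprS IH fpsCM !fpsCE ?exprS ?mulr0.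
Qed.

Lemma resolvent_coef s a N :
  resolvent s a N = \sum_(n < N.+1) (s ^+ n) (N - n)%N *: a ^+ n.
Proof.
rewrite /resolvent /geo fpsum_coef; apply: eq_bigr => n _.
rewrite exprMn_comm; last exact: fps_scalC.
rewrite fpsCX -fps_scalX fpsM big_ord_recr /= subnn big1 ?add0r => [|i _].
  by rewrite fps_scalE fpsCE -scalerAl mul1r.
rewrite fpsCE; case Ni : (_ - i)%N => [|m]; last by rewrite mulr0.
by have := ltn_ord i; rewrite -subn_gt0 Ni.
Qed.

Lemma tau_resolvent s a :
  fps_tau (resolvent s a) = momser (fun n => tau (a ^+ n)) s.
Proof.
apply: fpsP => N; rewrite fps_tauE resolvent_coef momser_coef linear_sum.
by apply: eq_bigr => n _; rewrite linearZ /= mulrC.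
Qed.


(** The reason for multiplicativity: if [P] and [Q] are the inverses of
    [1 - z u] and [1 - z v], both with expectation [1 + z], then [p] and [q] are
    centered, and the resolvent of the product at the parameter [z * (1 + z)]
    is expressed by the product [p * q] of centered elements. *)
Lemma resolvent_factor (T : nzRingType) (z u v P Q p q : T) :
  (forall x, x * z = z * x) -> P = 1 + z * (1 + p) -> Q = 1 + z * (1 + q) ->
  P * u = 1 + p -> v * Q = 1 + q ->
  P * (1 - z * ((1 + z) * (u * v))) * Q = 1 - z * (p * q - 1).
Proof.
move=> zC PE QE Pu vQ.
have -> : P * (1 - z * ((1 + z) * (u * v))) * Q =
    P * Q - z * ((1 + z) * ((1 + p) * (1 + q))).
  rewrite mulrBr mulr1 mulrBl; congr (_ - _).
  rewrite !mulrA zC -!mulrA; congr (_ * _); rewrite -Pu -vQ.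
  by rewrite mulrA mulrDr mulr1 zC -[P in X in X + _]mul1r -mulrDl -!mulrA.
have -> : p * q - 1 = (1 + p) * (1 + q) - (1 + p) - (1 + q).
  rewrite mulrDr mulr1 mulrDl mul1r !opprD !addrA.
  by rewrite [RHS](ACl (4*(1*5)*(2*6)*(3*8)*7)) /= !subrr !addr0.
rewrite PE QE {PE QE Pu vQ}; move: (1 + p) (1 + q) => g h.
rewrite !mulrDl !mul1r !mulrDr !mulr1 !mulrN.
have -> : z * g * (z * h) = z * (z * (g * h)) by rewrite -!mulrA (mulrA g) zC -mulrA.
set V := z * (z * _); set W := z * _; rewrite !opprD !opprK !addrA.
by rewrite [LHS](ACl (1*5*3*2*(4*6))) /= subrr addr0.
Qed.

Lemma left_inv_conj (T : nzRingType) (L P D X : T) :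
  L * P = 1 -> P * D * X = 1 -> D * (X * P) = 1.
Proof.
move=> LP PDX; rewrite -[LHS]mul1r -{1}LP.
have -> : L * P * (D * (X * P)) = L * (P * D * X) * P by rewrite !mulrA.
by rewrite PDX mulr1.
Qed.

Lemma resolvent_expand (T : nzRingType) (z c P Q N M p q : T) :
  (forall x, x * z = z * x) -> (forall x, c * x = x * c) -> 1 + z = c ->
  P = 1 + z * (1 + p) -> Q = 1 + z * (1 + q) -> c * N = 1 + z * M ->
  p * q * N = M ->
  P * Q * N = c + z * (p + q + c * M + z * (p * M + q * M + M)).
Proof.
move=> zC cC cE PE QE cN pqN.
have {PE} -> : P = c + z * p by rewrite PE mulrDr mulr1 addrA cE.
have {QE} -> : Q = c + z * q by rewrite QE mulrDr mulr1 addrA cE.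
rewrite !mulrDr !mulrDl.
have -> : c * c * N = c + z * (c * M) by rewrite -mulrA cN mulrDr mulr1 !mulrA zC.
have -> : z * p * c * N = z * p + z * (z * (p * M)).
  by rewrite -mulrA cN mulrDr mulr1 -!mulrA (mulrA p) zC -mulrA.
have -> : c * (z * q) * N = z * q + z * (z * (q * M)).
  by rewrite cC -mulrA cN mulrDr mulr1 -!mulrA (mulrA q) zC -mulrA.
have -> : z * p * (z * q) * N = z * (z * M).
  by rewrite -pqN -!mulrA (mulrA p) zC -!mulrA.
by rewrite !addrA [LHS](ACl (1*3*5*2*4*6*7)).
Qed.

(** Multiplicativity of the S-transform. With [P], [Q] the resolvents of [a] and
    [x], [resolvent_factor] shows that the resolvent of [a * x] is [Q * N * P],
    with [N] the inverse of [1 + Z - Z p q]. Up to the central factor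
    [1 + Z], each term of the expansion of [P * Q * N] other than [1 + Z] has
    its coefficients in the span of alternating words, or becomes so after a
    cyclic permutation, so that its expectation vanishes. *)
Lemma momser_free_mul (J : set I) i0 a x s t :
  ~ J i0 -> E i0 a -> (forall n, const_alt J (x ^+ n)) ->
  momser (fun n => tau (a ^+ n)) s = 1 + fpsZ ->
  momser (fun n => tau (x ^+ n)) t = 1 + fpsZ ->
  momser (fun n => tau ((a * x) ^+ n)) ((1 + fpsZ) * (s * t)) = 1 + fpsZ.
Proof.
move=> Ji0 Ea Xx sa tx.
pose u := fps_scal s * fpsC a; pose v := fps_scal t * fpsC x.
pose P := resolvent s a; pose Q := resolvent t x.
have [p Pu] : exists p, P * u = 1 + p by exists (P * u - 1); rewrite addrC subrK.
have [q vQ] : exists q, v * Q = 1 + q by exists (v * Q - 1); rewrite addrC subrK.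
have PE : P = 1 + fpsZ * (1 + p) by rewrite -Pu; apply: geoEr.
have QE : Q = 1 + fpsZ * (1 + q) by rewrite -vQ; apply: geoEl.
have Ea_n n : E i0 (a ^+ n) by elim: n => [|n IH] //; rewrite exprS; apply: EM.
have E0 : E i0 0 by rewrite -(addNr 1) -scaleN1r; apply: ED.
have P_p n : P n.+1 = p n + (1 : fps A) n.
  by rewrite PE fpsD fpsZM fps1 add0r fpsD addrC.
have Q_q n : Q n.+1 = q n + (1 : fps A) n.
  by rewrite QE fpsD fpsZM fps1 add0r fpsD addrC.
have tp n : tau (p n) = 0.
  have := congr1 (fun f : fps K => f n.+1) sa; rewrite -tau_resolvent -/P fps_tauE.
  rewrite P_p linearD /= (fpsD 1 fpsZ) !fps1 add0r fpsZE eqSS.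
  have -> : tau (n == 0)%:R = (n == 0)%:R by case: eqP; rewrite ?tau1 ?linear0.
  by move=> /(canRL (addrK _)); rewrite subrr.
have tq n : tau (q n) = 0.
  have := congr1 (fun f : fps K => f n.+1) tx; rewrite -tau_resolvent -/Q fps_tauE.
  rewrite Q_q linearD /= (fpsD 1 fpsZ) !fps1 add0r fpsZE eqSS.
  have -> : tau (n == 0)%:R = (n == 0)%:R by case: eqP; rewrite ?tau1 ?linear0.
  by move=> /(canRL (addrK _)); rewrite subrr.
pose V F G y := altspan setT G F y.
have pV n : V [set i0] [set i0] (p n).
  apply: (@AltLetter _ _ _ i0) => //.
  have -> : p n = (-1 : K) *: (1 : fps A) n + P n.+1.
    by rewrite P_p scaleN1r addrCA addNr addr0.
  apply: ED; first by rewrite fps1; case: eqP.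
  rewrite resolvent_coef; elim/big_ind: _ => // [y z Ey Ez|k _].
    by rewrite -[y]scale1r; apply: ED.
  by rewrite -[_ *: _]addr0; apply: ED.
have qV n : V J J (q n).
  apply: (@altspan_sub J _ J _ J) => //; apply: const_alt_centered => //.
  have -> : q n = (-1 : K) *: (1 : fps A) n + Q n.+1.
    by rewrite Q_q scaleN1r addrCA addNr addr0.
  have X0 : const_alt J 0 by apply: const_alt_span; apply: Alt0.
  apply: const_altD; first by rewrite fps1; case: eqP => _ //; apply: const_alt1.
  rewrite resolvent_coef; elim/big_ind: _ => // [y z Ey Ez|k _].
    by rewrite -[y]scale1r; apply: const_altD.
  by rewrite -[_ *: _]addr0; apply: const_altD.
have J0 i : J i -> [set i0] i -> False by move=> Ji /= ii0; apply: Ji0; rewrite -ii0.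
have iJ i : [set i0] i -> J i -> False by move=> ii0 Ji; apply: J0 Ji ii0.
have [N [NE NI]] : exists N : fps A, N = 1 + fpsZ * ((p * q - 1) * N) /\
    (1 - fpsZ * (p * q - 1)) * N = 1.
  by exists (geo (p * q - 1)); split; [apply: geoEl|apply: geo_invr].
(* By [cN] below, [N] is [1 + Z M] up to a factor [1 + Z]; the coefficients of
   [M] are combinations of words [p q p q ... p q]. *)
have [M ME] : exists M, p * q * N = M by exists (p * q * N).
have cC (f : fps A) : (1 + fpsZ) * f = f * (1 + fpsZ).
  by rewrite mulrDl mulrDr mul1r mulr1 fpsMZ.
have cN : (1 + fpsZ) * N = 1 + fpsZ * M.
  rewrite mulrDl mul1r {1}NE -ME mulrBl mul1r mulrBr addrA subrK //.
have pqV n : V [set i0] J ((p * q) n).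
  by rewrite fpsM; apply: altspan_sum => i; apply: (altspanM iJ (pV _) (qV _)).
have VM (f g : fps A) F G F' G' n : (forall i, G i -> F' i -> False) ->
    (forall n, V F G (f n)) -> (forall k, (k <= n)%N -> V F' G' (g k)) ->
    V F G' ((f * g) n).
  move=> GF fV gV; rewrite fpsM; apply: altspan_sum => i.
  by apply: (altspanM GF (fV _)); apply: gV; apply: leq_subr.
(* The equation [cM] determines the coefficients of [M] by recursion. *)
have MV n : V [set i0] J (M n).
  have cM : M + fpsZ * M = p * q + fpsZ * (p * q * M).
    rewrite -[X in X + _]mul1r -mulrDl -{1}ME mulrA (cC (p * q)) -mulrA cN.
    by rewrite mulrDr mulr1 [p * q * (_ * _)]mulrA fpsMZ -mulrA.
  elim/ltn_ind: n => n IH.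
  have -> : M n = (p * q) n + (fpsZ * (p * q * M)) n - (fpsZ * M) n.
    by rewrite -fpsD -cM fpsD addrK.
  rewrite !fpsZM; case: n IH => [|n] IH.
    by rewrite subr0 addr0; apply: pqV.
  apply: altspanB; last exact: IH.
  by apply: (altspanD (pqV _)); apply: (VM _ _ _ _ _ _ _ J0 pqV).
have tau0 (f : fps A) F G : (forall n, V F G (f n)) -> fps_tau f = 0.
  move=> fV; apply: fpsP => n; rewrite fps_tauE fps0.
  exact: tau_altspan (fV n).
have tM : fps_tau M = 0 by apply: tau0 MV.
have tpM : fps_tau (p * M) = 0.
  rewrite fps_tauC; apply: (tau0 _ [set i0] [set i0]) => n.
  exact: (VM _ _ _ _ _ _ _ J0 MV).
have tqM : fps_tau (q * M) = 0.
  by apply: (tau0 _ J J) => n; apply: (VM _ _ _ _ _ _ _ J0 qV).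
have t0p : fps_tau p = 0 by apply: tau0 pV.
have t0q : fps_tau q = 0 by apply: tau0 qV.
have PDQN : P * (1 - fpsZ * ((1 + fpsZ) * (u * v))) * Q * N = 1.
  by rewrite (resolvent_factor _ PE QE Pu vQ) // => f; apply: fpsMZ.
have DE : fps_scal ((1 + fpsZ) * (s * t)) * fpsC (a * x) = (1 + fpsZ) * (u * v).
  rewrite fps_scalM fps_scalD fps_scal1 fps_scalZ -mulrA; congr (_ * _).
  rewrite /u /v fps_scalM -!mulrA; congr (_ * _).
  rewrite [RHS]mulrA -fps_scalC -mulrA; congr (_ * _).
  by apply: fpsP => -[|n]; rewrite fpsCM !fpsCE ?mulr0.
rewrite -tau_resolvent /resolvent DE.
have -> : geo ((1 + fpsZ) * (u * v)) = Q * N * P.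
  set D := 1 - _ in PDQN; set w := (1 + _) * _ in D PDQN *.
  have DQN : D * (Q * N * P) = 1.
    by apply: (@left_inv_conj _ (1 - fpsZ * u)); [apply: geo_invr|rewrite mulrA].
  by rewrite -[LHS]mulr1 -DQN mulrA geo_invl mul1r.
rewrite fps_tauC mulrA (resolvent_expand _ cC erefl PE QE cN ME); last first.
  by move=> f; apply: fpsMZ.
have tc f : fps_tau ((1 + fpsZ) * f) = (1 + fpsZ) * fps_tau f.
  by rewrite !mulrDl !mul1r fps_tauD fps_tauZ.
rewrite fps_tauD -[X in fps_tau X + _]mulr1 tc fps_tau1 mulr1 fps_tauZ.
by rewrite !fps_tauD t0p t0q tc tM fps_tauZ !fps_tauD tpM tqM tM !(addr0, mulr0).
Qed.

End Free.

(** * Density of the even polynomials *)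

Section FourthRoot.
Context {R : realType}.

(** Newton-like iteration towards the fourth root with a constant step: on
    [0, 1] it increases and stays below the root. *)
Fixpoint root4_approx (m : nat) : {poly R} :=
  if m is m'.+1 then
    root4_approx m' + 4^-1 *: ('X - root4_approx m' ^+ 4)
  else 0.

(** Each step multiplies the error [y - g] by at most [1 - u] with
    [u = y ^+ 3 / 4], and [(1 - u) * (1 + m.+1 u) <= 1 + m u]. *)
Lemma root4_approxP (y : R) m : 0 <= y <= 1 ->
  let g := (root4_approx m).[y ^+ 4] in
  [/\ 0 <= g, g <= y & (y - g) * (1 + m%:R * (y ^+ 3 / 4)) <= y].
Proof.
move=> /andP[y0 y1]; elim: m => [|m [g0 gy IH]].
  by rewrite /= horner0 mul0r addr0 mulr1 subr0.
have -> : (root4_approx m.+1).[y ^+ 4] = (root4_approx m).[y ^+ 4] +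
    4^-1 * (y ^+ 4 - (root4_approx m).[y ^+ 4] ^+ 4) by rewrite /= !hornerE.
set g := (root4_approx m).[_] in g0 gy IH *.
have [u uE] : exists u, y ^+ 3 / 4 = u by exists (y ^+ 3 / 4).
rewrite uE in IH *.
have y31 : y ^+ 3 <= 1 by rewrite exprn_ile1.
have u0 : 0 <= u by rewrite -uE mulr_ge0 ?exprn_ge0.
have u1 : 4 * u <= 1 by rewrite -uE; lra.
pose w := y ^+ 3 + y ^+ 2 * g + y * g ^+ 2 + g ^+ 3.
have w0 : 4 * u <= w.
  rewrite /w -uE; suff : 0 <= y ^+ 2 * g + y * g ^+ 2 + g ^+ 3 by lra.
  by rewrite !addr_ge0 ?mulr_ge0 ?exprn_ge0.
have g1 : g <= 1 by apply: le_trans gy y1.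
have w4 : w <= 4 * y ^+ 3.
  suff [h1 h2 h3] : [/\ y ^+ 2 * g <= y ^+ 3, y * g ^+ 2 <= y ^+ 3 & g ^+ 3 <= y ^+ 3].
    by rewrite /w; lra.
  split; rewrite ?lerXn2r ?nnegrE //.
    by rewrite [y ^+ 3]exprSr ler_wpM2l ?exprn_ge0.
  by rewrite [y ^+ 3]exprS ler_wpM2l // lerXn2r ?nnegrE.
have gE : y ^+ 4 - g ^+ 4 = (y - g) * w by rewrite /w; ring.
have e0 : 0 <= y - g by rewrite subr_ge0.
have -> : g + 4^-1 * (y ^+ 4 - g ^+ 4) = g + (y - g) * (w / 4) by rewrite gE; field.
have w14 : w / 4 <= 1 by lra.
have ew : 0 <= (y - g) * (w / 4) by rewrite mulr_ge0 //; lra.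
split; first by lra.
  have : (y - g) * (w / 4) <= (y - g) * 1 by rewrite ler_wpM2l.
  by lra.
apply: le_trans IH.
have -> : y - (g + (y - g) * (w / 4)) = (y - g) * (1 - w / 4) by ring.
rewrite -mulrA ler_wpM2l //.
have m0 : 0 <= m%:R :> R by [].
apply: (@le_trans _ _ ((1 - u) * (1 + m.+1%:R * u))).
  by rewrite ler_wpM2r ?addr_ge0 ?mulr_ge0 //; lra.
rewrite -natr1; nra.
Qed.

(** The fourth root is used, rather than the square root, so that the
    approximant [g ^+ 2] of the square root is itself a square, hence positive
    on every positive functional. *)
Lemma poly_root4 (L d : R) : 0 < L -> 0 < d ->
  exists g : {poly R}, forall x, 0 <= x <= L -> 0 <= x - g.[x] ^+ 4 <= d.
Proof.
move=> L0 d0.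
pose m := (Num.truncn (16 * L / d)).+1.
pose l := Num.sqrt (Num.sqrt L).
have l4 : l ^+ 4 = L.
  by rewrite (exprM l 2 2) sqr_sqrtr ?sqrtr_ge0 // sqr_sqrtr // ltW.
exists (l *: (root4_approx m \Po (L^-1 *: 'X))) => x /andP[x0 xL].
rewrite hornerZ horner_comp hornerZ hornerX exprMn l4.
pose y := Num.sqrt (Num.sqrt (L^-1 * x)).
have xL0 : 0 <= L^-1 * x by rewrite mulr_ge0 // invr_ge0 ltW.
have y4 : y ^+ 4 = L^-1 * x.
  by rewrite (exprM y 2 2) sqr_sqrtr ?sqrtr_ge0 // sqr_sqrtr.
have y01 : 0 <= y <= 1.
  rewrite sqrtr_ge0 /= -[leRHS]sqrtr1 ler_wsqrtr // -[leRHS]sqrtr1 ler_wsqrtr //.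
  by rewrite mulrC ler_pdivrMr // mul1r.
have := root4_approxP m y01; rewrite /= y4; set g := (root4_approx m).[_].
move=> [g0 gy ge].
have -> : x - L * g ^+ 4 = L * (y ^+ 4 - g ^+ 4).
  by rewrite y4; field; rewrite gt_eqF.
have /andP[y0 y1] := y01.
have g4y : g ^+ 4 <= y ^+ 4 by rewrite lerXn2r ?nnegrE.
apply/andP; split; first by rewrite mulr_ge0 ?subr_ge0 // ltW.
have gm : m%:R * (y ^+ 4 - g ^+ 4) <= 16.
  have gE : y ^+ 4 - g ^+ 4 = (y - g) * (y ^+ 3 + y ^+ 2 * g + y * g ^+ 2 + g ^+ 3) by ring.
  have w4 : y ^+ 3 + y ^+ 2 * g + y * g ^+ 2 + g ^+ 3 <= 4 * y ^+ 3.
    suff [h1 h2 h3] : [/\ y ^+ 2 * g <= y ^+ 3, y * g ^+ 2 <= y ^+ 3 & g ^+ 3 <= y ^+ 3].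
      by lra.
    split; rewrite ?lerXn2r ?nnegrE //.
      by rewrite [y ^+ 3]exprSr ler_wpM2l ?exprn_ge0.
    by rewrite [y ^+ 3]exprS ler_wpM2l // lerXn2r ?nnegrE.
  have e0 : 0 <= y - g by rewrite subr_ge0.
  have : m%:R * ((y - g) * (y ^+ 3 + y ^+ 2 * g + y * g ^+ 2 + g ^+ 3)) <=
         m%:R * ((y - g) * (4 * y ^+ 3)).
    by rewrite ler_wpM2l // ler_wpM2l.
  rewrite gE; lra.
have dm : 16 * L <= d * m%:R.
  rewrite -ler_pdivrMl // mulrC ltW //; exact: truncnS_gt.
have m0 : 0 < m%:R :> R by rewrite ltr0n.
rewrite -(ler_pM2l m0); nra.
Qed.

End FourthRoot.

Section EvenDense.
Context {R : realType}.
Variables (L : R) (phi : {scalar {poly R}}).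
Hypothesis L0 : 0 < L.
Hypothesis phi_sqr : forall p, 0 <= phi (p ^+ 2).
Hypothesis phi_Xsqr : forall p, 0 <= phi ('X * p ^+ 2).
Hypothesis phi_even : forall q : {poly R},
  (forall x, 0 <= x <= L -> 0 <= q.[x]) -> 0 <= phi (q \Po 'X^2).

(** A weak form of the Cauchy-Schwarz inequality: the term [+ 1] spares the
    discussion of vanishing norms. *)
Lemma weak_cauchy_schwarz (a x y : R) :
  0 <= y -> (forall s, 0 <= x - 2 * s * a + s ^+ 2 * y) -> a ^+ 2 <= x * (y + 1).
Proof.
move=> y0 H; have y1 : 0 < y + 1 by lra.
have := H (a / (y + 1)); set s := a / _.
have -> : a = s * (y + 1) by rewrite /s divfK // gt_eqF.
nra.
Qed.

Lemma polyC2 : (2 : R)%:P = 2 :> {poly R}.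
Proof. exact: (rmorph_nat (@polyC R) 2). Qed.

Lemma phi_cs w p q : (forall r, 0 <= phi (w * r ^+ 2)) ->
  phi (w * (p * q)) ^+ 2 <= phi (w * p ^+ 2) * (phi (w * q ^+ 2) + 1).
Proof.
move=> w0; apply: weak_cauchy_schwarz => // s.
have := w0 (p - s *: q); congr (0 <= _).
have -> : w * (p - s *: q) ^+ 2 =
   w * p ^+ 2 - (2 * s) *: (w * (p * q)) + (s ^+ 2) *: (w * q ^+ 2).
  by rewrite -!mul_polyC polyC_exp polyCM polyC2; ring.
by rewrite linearD linearB /= !linearZ.
Qed.

(** The functional [phi] behaves like a measure on the half line whose image under
    squaring lives on [0, L], for which ['X] is the square root of ['X^2]. Writing
    [p] by its even and odd parts reduces the claim to approximating [h * 'X] by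
    [h * f ^+ 2], [f = g \Po 'X^2] with [g] close to the fourth root. Let
    [s = 'X - f ^+ 2] and [D = s * ('X + f ^+ 2) = 'X^2 - f ^+ 4], which is even
    and small on [0, L] as a polynomial in ['X^2]. Instead of dividing by
    ['X + f ^+ 2], use [s ^+ 2 = 2 'X s - D], which bounds [T = phi (h^2 s^2)] by
    [2 phi ('X * s * h^2)]; the Cauchy-Schwarz inequality for the weight ['X]
    bounds this in turn by means of [S = phi ('X h^2 s^2) <= phi (h^2 D s)]. *)
Lemma even_dense (p : {poly R}) (e : R) : 0 < e ->
  exists q, phi ((p - (q \Po 'X^2)) ^+ 2) <= e.
Proof.
move=> e0; pose h := odd_poly p \Po 'X^2.
pose B := phi ('X * h ^+ 2); pose M := phi (h ^+ 2 * 'X ^+ 2); pose H := phi (h ^+ 2).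
have B0 : 0 <= B by apply: phi_Xsqr.
have M0 : 0 <= M by rewrite /M -exprMn; apply: phi_sqr.
have H0 : 0 <= H by apply: phi_sqr.
pose C := 16 * (B + 1) ^+ 2 * (H * (4 * M + 1)) + 1.
have C0 : 1 <= C.
  by rewrite /C lerDr !mulr_ge0 ?exprn_ge0 ?addr_ge0 ?mulr_ge0.
have [d d0 dC] : exists2 d, 0 < d & C * d ^+ 2 <= e ^+ 4.
  exists (e ^+ 2 / C); first by rewrite divr_gt0 ?exprn_gt0 // (lt_le_trans _ C0).
  have -> : C * (e ^+ 2 / C) ^+ 2 = e ^+ 4 / C by field; rewrite gt_eqF // (lt_le_trans _ C0).
  by rewrite ler_pdivrMr ?(lt_le_trans _ C0) // ler_peMr // exprn_ge0 // ltW.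
have [g gd] := poly_root4 L0 d0.
pose f := g \Po 'X^2; pose s : {poly R} := 'X - f ^+ 2.
exists (even_poly p + odd_poly p * g ^+ 2).
have -> : p - ((even_poly p + odd_poly p * g ^+ 2) \Po 'X^2) = h * s.
  rewrite -{1}(poly_even_odd p) comp_polyD comp_polyM rmorphXn /= /h /s -/f.
  by ring.
set T := phi _.
pose D : {poly R} := 'X^2 - f ^+ 4.
have DE : D = s * ('X + f ^+ 2) by rewrite /D /s; ring.
have D_even : D = ('X - g ^+ 4) \Po 'X^2.
  by rewrite comp_polyB comp_polyX rmorphXn.
have D1 : 0 <= phi (h ^+ 2 * D).
  rewrite D_even /h -rmorphXn -rmorphM /=; apply: phi_even => x xL.
  by rewrite !hornerE mulr_ge0 ?exprn_even_ge0 //; case/andP: (gd x xL).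
have D2 : phi (h ^+ 2 * D ^+ 2) <= d ^+ 2 * H.
  rewrite /H -subr_ge0 -linearZ -linearB /=.
  have -> : d ^+ 2 *: h ^+ 2 - h ^+ 2 * D ^+ 2 =
      (odd_poly p ^+ 2 * ((d ^+ 2)%:P - ('X - g ^+ 4) ^+ 2)) \Po 'X^2.
    rewrite comp_polyM comp_polyB !rmorphXn /= -D_even comp_polyC -/h -mul_polyC.
    by rewrite polyC_exp; ring.
  apply: phi_even => x xL; have /andP[gx0 gxd] := gd x xL.
  rewrite !hornerE mulr_ge0 ?exprn_even_ge0 //=.
  by rewrite subr_ge0 lerXn2r ?nnegrE // ltW.
have T0 : 0 <= T by apply: phi_sqr.
have TM : T <= 4 * M.
  have f4 : phi (h ^+ 2 * f ^+ 4) <= M.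
    rewrite /M -subr_ge0 -linearB /= -mulrBr.
    by have -> : 'X ^+ 2 - f ^+ 4 = D by [].
  have := phi_sqr (h * ('X + f ^+ 2)).
  have -> : (h * ('X + f ^+ 2)) ^+ 2 =
     2 *: (h ^+ 2 * 'X ^+ 2) + 2 *: (h ^+ 2 * f ^+ 4) - (h * s) ^+ 2.
    by rewrite /s -!mul_polyC polyC2; ring.
  by rewrite linearB linearD !linearZ /= -/M -/T; lra.
pose S := phi ('X * (h * s) ^+ 2).
have S0 : 0 <= S by apply: phi_Xsqr.
have SD : S <= phi ((h * D) * (h * s)).
  have := phi_sqr (h * s * f).
  have -> : (h * s * f) ^+ 2 = (h * D) * (h * s) - 'X * (h * s) ^+ 2.
    by rewrite DE; ring.
  by rewrite linearB /= -/S; lra.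
have S2 : S ^+ 2 <= d ^+ 2 * H * (4 * M + 1).
  have := @phi_cs 1 (h * D) (h * s); rewrite !mul1r => cs.
  apply: (@le_trans _ _ (phi (h * D * (h * s)) ^+ 2)).
    by rewrite lerXn2r ?nnegrE // (le_trans S0).
  apply: le_trans (cs _) _; first by move=> r; rewrite mul1r.
  rewrite -/T exprMn ler_pM //; last by lra.
    by rewrite -exprMn.
  by rewrite addr_ge0.
have T2 : T ^+ 2 <= 4 * (S * (B + 1)).
  have TE : T = 2 * phi ('X * ((h * s) * h)) - phi (h ^+ 2 * D).
    rewrite -linearZ -linearB /=; congr (phi _).
    by rewrite /D /s -!mul_polyC polyC2; ring.
  have cs := @phi_cs 'X (h * s) h phi_Xsqr.
  rewrite -/S -/B in cs.
  have : T ^+ 2 <= (2 * phi ('X * ((h * s) * h))) ^+ 2.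
    by rewrite lerXn2r ?nnegrE //; lra.
  by rewrite exprMn; lra.
have T4 : T ^+ 4 <= C * d ^+ 2.
  have -> : T ^+ 4 = (T ^+ 2) ^+ 2 by rewrite -exprM.
  apply: (@le_trans _ _ ((4 * (S * (B + 1))) ^+ 2)).
    by rewrite lerXn2r ?nnegrE ?exprn_ge0 ?mulr_ge0 ?addr_ge0.
  rewrite !exprMn /C.
  have b0 : 0 <= (B + 1) ^+ 2 by rewrite exprn_ge0 ?addr_ge0.
  have : S ^+ 2 * (B + 1) ^+ 2 <= d ^+ 2 * H * (4 * M + 1) * (B + 1) ^+ 2.
    by rewrite ler_wpM2r.
  have : 0 <= d ^+ 2 by rewrite exprn_ge0 // ltW.
  lra.
have : T ^+ 4 <= e ^+ 4 by apply: le_trans T4 dC.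
by rewrite ler_pXn2r ?nnegrE // ltW.
Qed.

End EvenDense.

(** * Tracial states and L2 closures *)

Section TracialState.
Local Open Scope complex_scope.
Context {R : realType} {A : cstarAlgType R} (tau : {scalar A}).
Hypothesis tau_state : tracial_state tau.
Local Notation C := R[i].

Lemma star_add (x y : A) : star (x + y) = star x + star y.
Proof. exact: starD. Qed.

Lemma star_scale (c : C) (x : A) : star (c *: x) = conjc c *: star x.
Proof. exact: starZ. Qed.

Lemma star_mul (x y : A) : star (x * y) = star y * star x.
Proof. exact: starM. Qed.

Lemma star_opp (x : A) : star (- x) = - star x.
Proof. by rewrite -scaleN1r star_scale rmorphN1 scaleN1r. Qed.

Lemma star1 : star (1 : A) = 1.
Proof. by rewrite -[LHS]mulr1 -{2}(starK 1) -star_mul mulr1 starK. Qed.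

Definition rtau (x : A) : R := complex.Re (tau x).

Lemma rtauD x y : rtau (x + y) = rtau x + rtau y.
Proof. by rewrite /rtau linearD; case: (tau x) => a b; case: (tau y). Qed.

Lemma rtauZ (c : R) x : rtau (c%:C *: x) = c * rtau x.
Proof. by rewrite /rtau linearZ /=; case: (tau x) => a b /=; rewrite mul0r subr0. Qed.

Lemma rtauN x : rtau (- x) = - rtau x.
Proof. by rewrite /rtau linearN; case: (tau x). Qed.

Lemma rtauB x y : rtau (x - y) = rtau x - rtau y.
Proof. by rewrite rtauD rtauN. Qed.

Lemma rtauC x y : rtau (x * y) = rtau (y * x).
Proof. by rewrite /rtau; case: tau_state => _ _ ->. Qed.

Lemma rtau_ge0 x : 0 <= rtau (star x * x).
Proof.
by case: tau_state => _ /(_ x) + _; rewrite lecE => /andP[].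
Qed.

Lemma rtau_sym x y : rtau (star x * y) = rtau (star y * x).
Proof.
have im0 z : complex.Im (tau (star z * z)) = 0.
  by case: tau_state => _ /(_ z) + _; rewrite lecE => /andP[/eqP].
have := im0 (x + 'i *: y); rewrite star_add star_scale mulrDl !mulrDr.
rewrite -!scalerAl -!scalerAr !linearD !linearZ /=.
have := im0 x; have := im0 y; rewrite /rtau.
case: (tau (star x * x)) => a1 b1; case: (tau (star y * y)) => a2 b2.
case: (tau (star x * y)) => a3 b3; case: (tau (star y * x)) => a4 b4 /= -> ->.
by lra.
Qed.

(** The squared L2 norm. *)
Definition norm2 (x : A) : R := rtau (star x * x).

Lemma norm2D x y : norm2 (x + y) <= 2 * norm2 x + 2 * norm2 y.
Proof.
rewrite -subr_ge0; have := rtau_ge0 (x - y); congr (0 <= _).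
rewrite /norm2 !star_add star_opp !mulrDl !mulrDr !mulrN !mulNr.
by rewrite !rtauD !rtauN; ring.
Qed.

Lemma norm2Z c x : norm2 (c *: x) = (complex.Re c ^+ 2 + complex.Im c ^+ 2) * norm2 x.
Proof.
rewrite /norm2 star_scale -scalerAl -scalerAr scalerA -rtauZ; congr (rtau (_ *: _)).
by case: c => a b; apply/eqP; rewrite eq_complex /=; apply/andP; split; apply/eqP; ring.
Qed.

Lemma norm2N x : norm2 (- x) = norm2 x.
Proof. by rewrite /norm2 star_opp mulrNN. Qed.

Lemma norm2_star x : norm2 (star x) = norm2 x.
Proof. by rewrite /norm2 starK rtauC. Qed.

Lemma rtau_cs x y : rtau (star x * y) ^+ 2 <= norm2 x * (norm2 y + 1).
Proof.
apply: weak_cauchy_schwarz => [|s]; first exact: rtau_ge0.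
have := rtau_ge0 (x - s%:C *: y).
have -> : star (x - s%:C *: y) * (x - s%:C *: y) = star x * x -
    s%:C *: (star x * y) - (s%:C *: (star y * x) - s%:C *: (s%:C *: (star y * y))).
  rewrite star_add star_opp star_scale conjc_real mulrDl !mulrDr mulrN !mulNr mulrN.
  by rewrite -!scalerAl -!scalerAr opprD opprK.
rewrite !rtauB !rtauZ (rtau_sym y x) /norm2; congr (0 <= _); ring.
Qed.

Definition L2closure (B : set A) : set A :=
  [set x | forall e : R, 0 < e -> exists2 y, B y & norm2 (x - y) <= e].

Lemma L2closure_lin (B : set A) c x y :
  (forall c x y, B x -> B y -> B (c *: x + y)) ->
  L2closure B x -> L2closure B y -> L2closure B (c *: x + y).
Proof.
move=> Blin xB yB e e0; pose k := complex.Re c ^+ 2 + complex.Im c ^+ 2.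
have k0 : 0 <= k by rewrite addr_ge0 ?sqr_ge0.
have d0 : 0 < e / (4 * (k + 1)) by rewrite divr_gt0 // mulr_gt0 // ltr_wpDl.
have [x' Bx' xx'] := xB _ d0.
have [y' By' yy'] : exists2 y', B y' & norm2 (y - y') <= e / 4.
  by apply: yB; rewrite divr_gt0.
exists (c *: x' + y'); first exact: Blin.
have -> : c *: x + y - (c *: x' + y') = c *: (x - x') + (y - y').
  by rewrite scalerBr opprD addrACA.
apply: le_trans (norm2D _ _) _; rewrite norm2Z -/k.
have : k * norm2 (x - x') <= e / 4.
  apply: (@le_trans _ _ ((k + 1) * (e / (4 * (k + 1))))).
    by apply: ler_pM => //; [exact: rtau_ge0|rewrite lerDl].
  by rewrite le_eqVlt; apply/orP; left; apply/eqP; field; rewrite gt_eqF // ltr_wpDl.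
by lra.
Qed.

Lemma sqr_arbitrarily_small (x c : R) :
  0 <= c -> (forall e, 0 < e -> x ^+ 2 <= e * c) -> x = 0.
Proof.
move=> c0 H; apply/eqP; rewrite -sqrf_eq0 eq_le sqr_ge0 andbT.
apply/ler_addgt0Pl => e e0; rewrite addr0.
apply: le_trans (H (e / (c + 1)) _) _; first by rewrite divr_gt0 // ltr_wpDl.
by rewrite mulrAC ler_pdivrMr ?ltr_wpDl // ler_wpM2l ?ltW // ltrDl.
Qed.

(** Freeness passes to closures in the L2 norm. Replacing the letters of a word
    one at a time, traciality moves the error to the first position, where the
    Cauchy-Schwarz inequality bounds it by its L2 norm alone. *)
Lemma free_L2closure (I : eqType) (B E : I -> set A) :
  (forall i, B i 1) ->
  (forall i c x y, B i x -> B i y -> B i (c *: x + y)) ->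
  (forall i, E i `<=` L2closure (B i)) ->
  (forall w, w <> [::] -> centered_word tau B w -> tau (wprod w) = 0) ->
  forall w, w <> [::] -> centered_word tau E w -> tau (wprod w) = 0.
Proof.
move=> B1 Blin EB B_free.
pose letter (F : I -> set A) (t : I * A) := F t.1 t.2 /\ tau t.2 = 0.
suff H : forall w1 w2, w1 ++ w2 <> [::] ->
    sorted (fun s t : I * A => s.1 != t.1) (w1 ++ w2) ->
    (forall t, t \in w1 -> letter E t) -> (forall t, t \in w2 -> letter B t) ->
    tau (wprod (w1 ++ w2)) = 0.
  by move=> w w0 [ws wE]; rewrite -[w]cats0; apply: H; rewrite ?cats0.
have sortedE (w : seq (I * A)) : sorted (fun s t : I * A => s.1 != t.1) w =
    sorted (fun i j : I => i != j) (map fst w) by rewrite sorted_map.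
elim/last_ind => [|w1 [i x] IH] w2 w0 ws wE wB; first exact: B_free.
rewrite cat_rcons in w0 ws *.
have [/= Ex tx] : letter E (i, x) by apply: wE; rewrite mem_rcons mem_head.
set z := wprod w2 * wprod w1.
have tauC u v : tau (u * v) = tau (v * u) by case: tau_state.
have tau1 : tau 1 = 1 by case: tau_state.
have wprodE y : tau (wprod (w1 ++ (i, y) :: w2)) = tau (y * z).
  by rewrite /wprod big_cat big_cons /= tauC -!mulrA.
(* The scalar [c] is used with values [1] and ['i], to reach the real and the
   imaginary parts of [tau (x * z)]. *)
have approx (c : C) (e : R) : 0 < e ->
    rtau (x * (c *: z)) ^+ 2 <= e * (10 * (norm2 (c *: z) + 1)).
  move=> e0; have [y By xy] := EB i x Ex e e0.
  pose y' := y - (tau y)%:A.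
  have ty' : tau y' = 0 by rewrite linearB /= linearZ /= tau1 mulr1 subrr.
  have By' : B i y'.
    by rewrite /y' addrC -scaleNr; apply: Blin.
  have zero : tau (y' * z) = 0.
    rewrite -wprodE; apply: IH.
    - by case: (w1).
    - by move: ws; rewrite !sortedE !map_cat.
    - by move=> t tw; apply: wE; rewrite mem_rcons inE tw orbT.
    - by move=> t; rewrite inE => /orP[/eqP -> //|]; apply: wB.
  have -> : rtau (x * (c *: z)) = rtau ((x - y') * (c *: z)).
    rewrite mulrBl rtauB [X in _ - X](_ : _ = 0) ?subr0 //.
    by rewrite /rtau -scalerAr linearZ /= zero mulr0.
  have := rtau_cs (star (x - y')) (c *: z); rewrite starK norm2_star => cs.
  apply: le_trans cs _; rewrite mulrA ler_wpM2r //.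
    by rewrite addr_ge0 ?rtau_ge0.
  set u := x - y in xy; have -> : x - y' = u - (tau u)%:A.
    have -> : tau u = - tau y by rewrite /u linearB /= tx sub0r.
    by rewrite scaleNr opprK /y' opprB addrA addrAC.
  have n1 : norm2 1 = 1 by rewrite /norm2 star1 mulr1 /rtau tau1.
  have re2 : complex.Re (tau u) ^+ 2 <= 2 * norm2 u.
    have := rtau_cs u 1; rewrite rtau_sym star1 mul1r n1 -/(rtau u); lra.
  have im2 : complex.Im (tau u) ^+ 2 <= 2 * norm2 u.
    have := rtau_cs ('i *: u) 1; rewrite rtau_sym star1 mul1r n1 norm2Z /=.
    by rewrite /rtau linearZ /=; case: (tau u) => a b /=; lra.
  apply: le_trans (norm2D _ _) _; rewrite norm2N norm2Z n1; lra.
rewrite wprodE.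
have n0 c : 0 <= 10 * (norm2 (c *: z) + 1).
  by rewrite mulr_ge0 // addr_ge0 ?rtau_ge0.
have := sqr_arbitrarily_small (n0 1) (approx 1).
have := sqr_arbitrarily_small (n0 'i) (approx 'i).
rewrite /rtau scale1r -scalerAr linearZ /=; case: (tau (x * z)) => a b /= ab ->.
by move: ab; rewrite mul0r mul1r sub0r => /eqP; rewrite oppr_eq0 => /eqP ->.
Qed.

End TracialState.

(** * Square roots of free elements are free *)

Section SquareRoot.
Context {R : realType} {A : cstarAlgType R} (tau : {scalar A}).
Hypothesis tau_state : tracial_state tau.
Local Open Scope complex_scope.
Local Notation C := R[i].
Local Notation rtau := (rtau tau).

Definition poly_alg (a : A) : set A := range (horner_alg a).

Lemma poly_alg1 a : poly_alg a 1.
Proof. by exists 1 => //; rewrite rmorph1. Qed.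

Lemma poly_algD a (c : C) x y : poly_alg a x -> poly_alg a y -> poly_alg a (c *: x + y).
Proof.
move=> [p _ <-] [q _ <-]; exists (c *: p + q) => //.
by rewrite linearP /= mulr_algl.
Qed.

Lemma poly_algM a x y : poly_alg a x -> poly_alg a y -> poly_alg a (x * y).
Proof. by move=> [p _ <-] [q _ <-]; exists (p * q) => //; rewrite rmorphM. Qed.

Lemma poly_alg_gen a : poly_alg a a.
Proof. by exists 'X => //; rewrite horner_algX. Qed.

Definition rpoly (a : A) (p : {poly R}) : A :=
  horner_alg a (map_poly (real_complex R) p).

Lemma rpolyD a p q : rpoly a (p + q) = rpoly a p + rpoly a q.
Proof. by rewrite /rpoly !rmorphD. Qed.

Lemma rpoly0 a : rpoly a 0 = 0.
Proof. by rewrite /rpoly !rmorph0. Qed.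

Lemma rpoly1 a : rpoly a 1 = 1.
Proof. by rewrite /rpoly !rmorph1. Qed.

Lemma rpolyM a p q : rpoly a (p * q) = rpoly a p * rpoly a q.
Proof. by rewrite /rpoly !rmorphM. Qed.

Lemma rpolyB a p q : rpoly a (p - q) = rpoly a p - rpoly a q.
Proof. by rewrite /rpoly !rmorphB. Qed.

Lemma rpolyC a (c : R) : rpoly a c%:P = (c%:C)%:A.
Proof. rewrite /rpoly map_polyC horner_algC. by []. Qed.

Lemma rpolyX a : rpoly a 'X = a.
Proof. by rewrite /rpoly map_polyX horner_algX. Qed.

Lemma rpolyZ a (c : R) p : rpoly a (c *: p) = c%:C *: rpoly a p.
Proof. by rewrite -mul_polyC rpolyM rpolyC -scalerAl mul1r. Qed.

Lemma rpoly_comp_sqr a p : rpoly a (p \Po 'X^2) = rpoly (a ^+ 2) p.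
Proof.
elim/poly_ind: p => [|p c IH]; first by rewrite comp_poly0 !rpoly0.
rewrite comp_poly_MXaddC !rpolyD !rpolyM IH !rpolyC; congr (_ * _ + _).
by rewrite [RHS]rpolyX !expr2 ?rpolyM !rpolyX.
Qed.

Variables (a b y : A).
Hypothesis bE : b = star y * y.
Hypothesis ab : b ^+ 2 = a.
Variable L : R.
Hypothesis L0 : 0 < L.
Hypothesis moments_pos : forall q : {poly R},
  (forall x, 0 <= x <= L -> 0 <= q.[x]) -> 0 <= rtau (rpoly a q).

Let star_b : star b = b.
Proof. by rewrite bE star_mul starK. Qed.

Let star_rpoly p : star (rpoly b p) = rpoly b p.
Proof.
have comm_b q : rpoly b q * b = b * rpoly b q.
  by have := congr1 (rpoly b) (mulrC q 'X); rewrite !rpolyM rpolyX.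
elim/poly_ind: p => [|p c IH].
  by rewrite rpoly0 -(scale0r 0) star_scale rmorph0 !scale0r.
rewrite rpolyD rpolyM rpolyX rpolyC star_add star_mul star_b IH star_scale.
by rewrite star1 conjc_real comm_b.
Qed.

Let phi (p : {poly R}) : R := rtau (rpoly b p).

Let phi_scalar : scalar phi.
Proof. by move=> c p q; rewrite /phi rpolyD rpolyZ rtauD rtauZ. Qed.

HB.instance Definition _ := GRing.isLinear.Build R {poly R} R *%R phi phi_scalar.

Lemma rpoly_closure p : L2closure tau (poly_alg a) (rpoly b p).
Proof.
move=> e e0.
have [|||q qe] := @even_dense R L phi L0 _ _ _ p e e0.
- move=> q; change (0 <= rtau (rpoly b (q ^+ 2))).
  rewrite expr2 rpolyM -{1}star_rpoly; exact: rtau_ge0.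
- move=> q; change (0 <= rtau (rpoly b ('X * q ^+ 2))).
  have -> : rtau (rpoly b ('X * q ^+ 2)) = rtau (star (y * rpoly b q) * (y * rpoly b q)).
    rewrite star_mul star_rpoly -mulrA (mulrA (star y)) -bE rtauC //.
    by rewrite expr2 !rpolyM rpolyX -mulrA.
  exact: rtau_ge0.
- move=> q qL; change (0 <= rtau (rpoly b (q \Po 'X^2))).
  by rewrite rpoly_comp_sqr ab; apply: moments_pos.
exists (rpoly a q); first by exists (map_poly (real_complex R) q).
have {}qe : rtau (rpoly b ((p - (q \Po 'X^2)) ^+ 2)) <= e by exact: qe.
apply: le_trans qe.
rewrite expr2 rpolyM rpolyB rpoly_comp_sqr ab.
rewrite /norm2 le_eqVlt; apply/orP; left; apply/eqP; congr (rtau (_ * _)).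
by rewrite -ab -rpoly_comp_sqr -rpolyB star_rpoly.
Qed.

(** The square root [b] of [a] need not be a polynomial in [a], but it is a limit
    of such polynomials in the L2 norm, and so are the polynomials in [b]. *)
Lemma poly_alg_closure : poly_alg b `<=` L2closure tau (poly_alg a).
Proof.
move=> x [p _ <-].
have -> : horner_alg b p = 'i *: rpoly b (map_poly (@complex.Im R) p) +
                           rpoly b (map_poly (@complex.Re R) p).
  rewrite /rpoly -mulr_algl -(horner_algC b) -rmorphM -rmorphD mul_polyC /=.
  congr (horner_alg b _); apply/polyP => i.
  rewrite coefD coefZ !coef_map_id0 //; rewrite addrC.
  exact: complexE.
apply: L2closure_lin => //; [exact: poly_algD|exact: rpoly_closure..].
Qed.

End SquareRoot.

Lemma free_poly_alg (R : realType) (A : cstarAlgType R) (tau : {scalar A})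
  (I : eqType) (a : I -> A) : free_elements tau a ->
  forall w : seq (I * A), w <> [::] ->
  centered_word tau (fun i => poly_alg (a i)) w -> tau (wprod w) = 0.
Proof.
move=> free [//|t w] _ [ws wE].
have gen i : poly_alg (a i) `<=` generated_star_subalgebra [set a i].
  move=> x [p _ <-] S [[S1 SD SM SS] aS].
  elim/poly_ind: p => [|p c IH].
    have -> : horner_alg (a i) 0 = (-1) *: 1 + 1 by rewrite rmorph0 scaleN1r addNr.
    exact: SD.
  rewrite rmorphD rmorphM /= horner_algX horner_algC addrC.
  by apply: SD => //; apply: SM => //; apply: aS.
pose u j := nth t (t :: w) j.
have := free (size w) (fun j => (u j).1) (fun j => (u j).2).
rewrite /wprod (big_nth t) /=; apply.
- move=> j jw; apply/eqP.
  by have /pathP := ws; move=> /(_ t j jw).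
- move=> j jw; apply: gen; have /wE[] : u j \in t :: w by rewrite mem_nth.
  by [].
- by move=> j jw; have /wE[] : u j \in t :: w by rewrite mem_nth.
Qed.

(** * Moments of the palindromic product *)

(** The first two moments are read off the two lowest coefficients of [s]. *)
Lemma momser_low (K : comNzRingType) (m : nat -> K) (s : fps K) :
  m 0%N = 1 -> momser m s = 1 + fpsZ ->
  m 1%N * s 0 = 1 /\ m 1%N * s 1 + m 2%N * s 0 ^+ 2 = 0.
Proof.
move=> m0 ms; split.
  have := congr1 (fun f : fps K => f 1) ms.
  rewrite momser_coef fpsD !big_ord_recr big_ord0 /= expr0 !fps1 fpsZE.
  by rewrite mulr0 !add0r expr1.
have := congr1 (fun f : fps K => f 2) ms.
rewrite momser_coef fpsD !big_ord_recr big_ord0 /= expr0 !fps1 fpsZE.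
by rewrite mulr0 !add0r expr1 fpsX0.
Qed.

Lemma momser_one (K : comNzRingType) :
  momser (fun=> 1) (geo (- 1)) = 1 + fpsZ :> fps K.
Proof.
have -> s : momser (fun=> 1) s = geo s :> fps K.
  apply: fpsP => n; rewrite momser_coef /geo fpsum_coef.
  by apply: eq_bigr => i _; rewrite mul1r.
have := geo_invr (geo (- 1) : fps K).
have E : (1 + fpsZ) * geo (- 1) = 1 :> fps K.
  by rewrite -[RHS](geo_invr (- 1)) mulrN1 opprK.
have -> : 1 - fpsZ * geo (- 1) = geo (- 1) :> fps K.
  by apply/eqP; rewrite subr_eq -[X in X == _]E mulrDl mul1r.
by move=> H; rewrite -[LHS]mul1r -[X in X * _]E -mulrA H mulr1.
Qed.

Lemma geo_coef0 (K : nzRingType) (f : fps K) : geo f 0 = 1.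
Proof. by rewrite geoEl fpsD fpsZM fps1 addr0. Qed.

Lemma geo_coef1 (K : nzRingType) (f : fps K) : geo f 1 = f 0.
Proof. by rewrite geoEl fpsD fpsZM fps1 add0r fpsM0 geo_coef0 mulr1. Qed.

Section Palindrome.
Context {R : realType} {A : cstarAlgType R} (tau : {scalar A}) (I : eqType).
Hypothesis tau_state : tracial_state tau.
Variable b : I -> A.
Local Notation C := R[i].
Local Notation E := (fun i => poly_alg (b i)).
Hypothesis b_free : forall w : seq (I * A), w <> [::] ->
  centered_word tau E w -> tau (wprod w) = 0.

(** The product [b_1 ... b_n b_n ... b_1], nested so as to peel off its ends. *)
Fixpoint pal (s : seq I) : A := if s is i :: s' then b i * pal s' * b i else 1.

Let m (i : I) (n : nat) : C := tau ((b i ^+ 2) ^+ n).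

Let tau1 : tau 1 = 1. Proof. by case: tau_state. Qed.
Let tauC x y : tau (x * y) = tau (y * x). Proof. by case: tau_state. Qed.

Lemma pal_const_alt s y : const_alt tau E [set i | i \in s] y ->
  const_alt tau E [set i | i \in s] (pal s * y).
Proof.
suff H s' : subseq s' s -> const_alt tau E [set i | i \in s] y ->
    const_alt tau E [set i | i \in s] (pal s' * y) by apply: H.
elim: s' y => [|i s' IH] y ss yJ; first by rewrite mul1r.
have is_ : i \in s by apply: (mem_subseq ss); rewrite mem_head.
have lmul z : const_alt tau E [set i | i \in s] z ->
    const_alt tau E [set i | i \in s] (b i * z).
  move=> zJ; apply: (@const_alt_lmul _ _ _ tau E) zJ => //.
  - by move=> j; apply: poly_alg1.
  - by move=> j c u v; apply: poly_algD.
  - by move=> j u v; apply: poly_algM.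
  - exact: is_.
  - exact: poly_alg_gen.
rewrite /= -!mulrA; apply: (lmul); apply: IH; last exact: lmul.
by apply: subseq_trans ss; apply: subseq_cons.
Qed.

Lemma palX_const_alt s n : const_alt tau E [set i | i \in s] (pal s ^+ n).
Proof.
elim: n => [|n IH]; first exact: const_alt1.
by rewrite exprS; apply: pal_const_alt.
Qed.

Lemma tau_conj_pow (c x : A) n : tau ((c * x * c) ^+ n) = tau ((c ^+ 2 * x) ^+ n).
Proof.
case: n => // n.
have E1 : (c * x * c) ^+ n.+1 = c * ((x * c ^+ 2) ^+ n * (x * c)).
  elim: n => [|n IH]; first by rewrite expr1 expr0 mul1r mulrA.
  by rewrite exprS IH [(x * c ^+ 2) ^+ n.+1]exprS expr2 !mulrA.
have E2 : (c ^+ 2 * x) ^+ n.+1 = c ^+ 2 * ((x * c ^+ 2) ^+ n * x).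
  elim: n {E1} => [|n IH]; first by rewrite expr1 expr0 mul1r.
  by rewrite exprS IH [(x * c ^+ 2) ^+ n.+1]exprS !mulrA.
by rewrite E1 E2 tauC [RHS]tauC expr2 !mulrA.
Qed.

Variable S : I -> fps C.
Hypothesis mS : forall i, momser (m i) (S i) = 1 + fpsZ.

Fixpoint palser (s : seq I) : fps C :=
  if s is i :: s' then (1 + fpsZ) * (S i * palser s') else geo (- 1).

(** By traciality [b_i * X * b_i] has the moments of [b_i ^+ 2 * X], and [X] is
    in the algebra generated by the other [b_j]. *)
Lemma momser_pal s : uniq s ->
  momser (fun n => tau (pal s ^+ n)) (palser s) = 1 + fpsZ.
Proof.
elim: s => [_|i s IH /= /andP[is_ us]].
  rewrite -[RHS]momser_one; congr (momser _ _); apply/funext => n.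
  by rewrite /= expr1n.
have -> : (fun n => tau ((b i * pal s * b i) ^+ n)) =
          (fun n => tau ((b i ^+ 2 * pal s) ^+ n)).
  by apply/funext => n; apply: tau_conj_pow.
apply: (@momser_free_mul _ _ _ tau E _ _ _ _ _ _ [set j | j \in s] i) => //.
- by move=> j; apply: poly_alg1.
- by move=> j c u v; apply: poly_algD.
- by move=> j u v; apply: poly_algM.
- exact/negP.
- by rewrite expr2; apply: poly_algM; apply: poly_alg_gen.
- by move=> n; apply: palX_const_alt.
- exact: mS.
- exact: IH.
Qed.

Hypothesis m1 : forall i, m i 1%N = 1.

Lemma palser_low s : palser s 0 = 1 /\
  palser s 1 = - (1 + \sum_(i <- s) (m i 2%N - 1)).
Proof.
have m0 i : m i 0%N = 1 by rewrite /m expr0.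
elim: s => [|i s [IH0 IH1]].
  by rewrite big_nil addr0 /= geo_coef0 geo_coef1 fpsN fps1.
have [] := momser_low (m0 i) (mS i); rewrite m1 !mul1r => S0.
rewrite S0 expr1n mulr1 => /eqP; rewrite addr_eq0 => /eqP S1.
rewrite big_cons /= mulrDl mul1r !fpsD !fpsZM !fpsM0 S0 IH0 mulr1 addr0.
split=> //; rewrite fpsM !big_ord_recr big_ord0 /= S0 IH0 IH1 S1 fpsM0 S0 IH0; ring.
Qed.

Lemma palser_moments s : uniq s ->
  tau (pal s) = 1 /\ tau (pal s ^+ 2) = 1 + \sum_(i <- s) (m i 2%N - 1).
Proof.
move=> us; have [p0 p1] := palser_low s.
have [] := momser_low _ (momser_pal us); first by rewrite expr0.
rewrite expr1 p0 p1 mulr1 => -> //; rewrite mul1r expr1n mulr1 => /eqP.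
by rewrite addrC addr_eq0 opprK => /eqP.
Qed.

End Palindrome.

Lemma bernoulli_ge (K : numDomainType) (x : K) n :
  0 <= x <= 1 -> 1 - n%:R * x <= (1 - x) ^+ n.
Proof.
move=> /andP[x0 x1]; elim: n => [|n IH]; first by rewrite mul0r subr0 expr0.
rewrite exprSr; apply: le_trans (ler_wpM2r _ IH); last by rewrite subr_ge0.
rewrite -subr_ge0.
have -> : (1 - n%:R * x) * (1 - x) - (1 - n.+1%:R * x) = n%:R * x ^+ 2.
  by rewrite -natr1; ring.
by rewrite mulr_ge0 ?exprn_ge0.
Qed.

Section PalindromeBound.
Context {R : realType} {A : cstarAlgType R} (tau : {scalar A}) (I : eqType).
Hypothesis tau_state : tracial_state tau.
Variable b : I -> A.
Local Open Scope complex_scope.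
Local Notation C := R[i].
Local Notation E := (fun i => poly_alg (b i)).
Hypothesis b_free : forall w : seq (I * A), w <> [::] ->
  centered_word tau E w -> tau (wprod w) = 0.
Local Notation m i n := (tau ((b i ^+ 2) ^+ n)).
Variable L : C.
Hypothesis L1 : 1 <= L.
Hypothesis m1 : forall i, m i 1%N = 1.
Hypothesis mL : forall i n, 0 <= m i n.+1 <= L ^+ n.

Let L0 : 0 <= L. Proof. exact: le_trans L1. Qed.

Lemma pal_series (r : C) : 0 <= r -> 6%:R * L * r <= 1 ->
  exists S H : I -> fps C, forall i, [/\ momser (fun n => m i n) (S i) = 1 + fpsZ,
    S i * H i = 1 & forall N, fnorm r N (H i) <= (1 - 2%:R * L * r)^-1].
Proof.
move=> r0 Lr.
have ex i : exists SH : fps C * fps C, [/\ momser (fun n => m i n) SH.1 = 1 + fpsZ,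
    SH.1 * SH.2 = 1 & forall N, fnorm r N SH.2 <= (1 - 2%:R * L * r)^-1].
  have m0 : m i 0%N = 1 by rewrite expr0; case: tau_state.
  have [S [H SH]] := @momser_inverse _ (fun n => m i n) L r m0 (m1 i) (mL i) L0 r0 Lr.
  by exists (S, H).
have [f fP] := choice ex.
by exists (fun i => (f i).1), (fun i => (f i).2).
Qed.

Lemma pal_moments (s : seq I) : uniq s ->
  tau (pal b s) = 1 /\ tau (pal b s ^+ 2) = 1 + \sum_(i <- s) (m i 2%N - 1).
Proof.
have [||S [H SH]] := @pal_series 0 => //; first by rewrite mulr0.
have mS i : momser (fun n => m i n) (S i) = 1 + fpsZ by have [] := SH i.
exact: palser_moments mS m1 s.
Qed.

(** With [k = size s], take the radius [r = (6 L k)^-1]. The inverse of the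
    series attached to the product has [2 k + 1] factors: [1 + Z], and [2 k]
    factors of norm at most [(1 - (3 k)^-1)^-1], whose product is at most [3] by
    the Bernoulli inequality. Lagrange inversion then bounds the moments. *)
Lemma pal_bound (s : seq I) n : uniq s -> (0 < size s)%N ->
  `|tau (pal b s ^+ n.+1)| <= (36%:R * L * (size s)%:R) ^+ n.+1.
Proof.
move=> us s0; set k := size s in s0 *.
have k0 : 0 < k%:R :> C by rewrite ltr0n.
have k1 : 1 <= k%:R :> C by rewrite ler1n.
have Lp : 0 < L by apply: lt_le_trans L1.
pose r := (6%:R * L * k%:R)^-1.
have D0 : 0 < 6%:R * L * k%:R by rewrite !mulr_gt0.
have r0 : 0 < r by rewrite invr_gt0.
have r0' : 0 <= r := ltW r0.
have Lrk : 6%:R * L * r = k%:R^-1.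
  by rewrite /r invfM mulrA divff ?mul1r // gt_eqF // mulr_gt0.
have Lr : 6%:R * L * r <= 1 by rewrite Lrk invf_le1.
have [S [H SH]] := pal_series r0' Lr.
pose x := (3%:R * k%:R)^-1 : C.
have xE : 2%:R * L * r = x.
  have -> : 2%:R * L * r = (6%:R * L * r) / 3%:R by field.
  by rewrite Lrk /x invfM mulrC.
have x0 : 0 <= x by rewrite invr_ge0 mulr_ge0.
have x1 : x < 1.
  by rewrite invf_lt1 ?mulr_gt0 // -natrM ltr1n (@leq_trans 3) // leq_pmulr.
have q0 : 0 < 1 - x by rewrite subr_gt0.
pose q := (1 - x)^-1.
have rx : r <= x.
  rewrite -xE -[leLHS]mul1r; apply: ler_wpM2r; first exact: ltW.
  by apply: le_trans L1 _; rewrite ler_peMl // ler1n.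
have q0' : 0 <= q by rewrite invr_ge0 ltW.
pose inv s := (1 + fpsZ) * \prod_(i <- s) (geo (- 1) * H i) : fps C.
have g1 : (1 + fpsZ) * geo (- 1) = 1 :> fps C.
  by rewrite -[RHS](geo_invr (- 1)) mulrN1 opprK.
have serinv s' : palser S s' * inv s' = 1.
  elim: s' => [|i s' IH]; first by rewrite /inv big_nil mulr1 mulrC.
  have [_ SHi _] := SH i; rewrite /inv big_cons /=.
  have regroup (a d e f g h : fps C) :
     a * (d * e) * (a * (f * g * h)) = (a * f) * (d * g) * (e * (a * h)) by ring.
  by rewrite regroup g1 SHi !mul1r.
have geoN N : fnorm r N (geo (- 1)) <= q.
  apply: le_trans (fnorm_fpsum r0' _ _) _.
  apply: (@le_trans _ _ (\sum_(n < N) x ^+ n)); last first.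
    by apply: geometric_sum_le; rewrite x0 x1.
  apply: ler_sum => j _; rewrite -[leRHS]mulr1 ler_pM ?fnorm_ge0 ?exprn_ge0 //.
    by rewrite lerXn2r ?nnegrE.
  apply: le_trans (fnormX r0' _ _ _) _; rewrite fnormN.
  by apply: exprn_ile1; rewrite ?fnorm_ge0 ?fnorm1.
have invN N : fnorm r N (inv s) <= 6%:R.
  apply: le_trans (fnormM r0' _ _ _) _.
  have -> : 6%:R = 2%:R * 3%:R :> C by rewrite -natrM.
  apply: ler_pM; rewrite ?fnorm_ge0 //.
    apply: le_trans (fnormD r0' _ _ _) _; rewrite [2%:R](natrD _ 1 1).
    apply: lerD; first exact: fnorm1.
    case: N => [|N]; first by rewrite /fnorm big_ord0.
    rewrite -[fpsZ]mulr1 fnormZM -[leRHS]mulr1; apply: ler_pM; rewrite ?fnorm_ge0 ?fnorm1 //.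
    exact: ltW (le_lt_trans rx x1).
  have prodN s' : fnorm r N (\prod_(i <- s') (geo (- 1) * H i)) <= (q ^+ 2) ^+ size s'.
    elim: s' => [|i s' IH]; first by rewrite big_nil fnorm1.
    rewrite big_cons [_ ^+ size _]exprS; apply: le_trans (fnormM r0' _ _ _) _.
    apply: ler_pM; rewrite ?fnorm_ge0 //.
    apply: le_trans (fnormM r0' _ _ _) _; rewrite expr2.
    apply: ler_pM; rewrite ?fnorm_ge0 ?geoN //.
    by have [_ _] := SH i; rewrite xE; apply.
  apply: le_trans (prodN s) _; rewrite -/k -exprM /q exprVn.
  have x01 : 0 <= x <= 1 by rewrite x0 ltW.
  have := bernoulli_ge (2 * k) x01.
  have -> : 1 - (2 * k)%:R * x = 3%:R^-1.
    by rewrite /x natrM; field; rewrite gt_eqF.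
  move=> B3; rewrite -[leRHS]invrK lef_pV2 ?posrE ?exprn_gt0 ?invr_gt0 //.
have := lagrange_bound n (momser_pal tau_state b_free _ us) (serinv s) r0' invN.
move=> /(_ (fun i => let: And3 e _ _ := SH i in e)) bnd.
have rn0 : 0 < r ^+ n by rewrite exprn_gt0.
rewrite -(ler_pM2r rn0); apply: le_trans bnd _.
have -> : 36%:R * L * k%:R = 6%:R * r^-1 by rewrite /r invrK; field.
rewrite exprMn -mulrA [r^-1 ^+ _]exprS -[_ * _ * r ^+ n]mulrA -exprMn.
rewrite mulVf ?gt_eqF // expr1n mulr1 ler_peMr ?exprn_ge0 // /r invrK.
rewrite -[leLHS]mulr1; apply: ler_pM => //.
by rewrite -[leLHS]mulr1; apply: ler_pM => //; rewrite ler1n.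
Qed.

End PalindromeBound.

(** * Moments of probability measures with bounded support *)

Section Support.
Context {R : realType} (mu : probability (measurableTypeR R) R).

(** Every point outside the support lies in a null open interval with rational
    ends, and there are countably many of these. *)
Lemma open_outside_msupport (U : set R) :
  open U -> U `&` msupport mu = set0 -> mu U = 0%E.
Proof.
move=> oU US.
pose itv (n : nat) : set R :=
  if unpickle n is Some pq then
    let V := `](ratr (pq : rat * rat).1 : R), ratr pq.2[%classic in
    if mu V == 0%E then V else set0
  else set0.
apply: (@measure_negligible _ (measurableTypeR R)); first exact: open_measurable.
apply: (@negligibleS _ (measurableTypeR R) _ _ (\bigcup_n itv n)); last first.
  apply: (@negligible_bigcup _ (measurableTypeR R)) => n; rewrite /itv.
  case: unpickle => [pq|]; last exact: negligible_set0.
  case: eqP => [V0|_]; last exact: negligible_set0.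
  by exists `](ratr pq.1 : R), ratr pq.2[%classic; split.
move=> x Ux.
have /existsNP[V /not_implyP[oV /not_implyP[Vx V0]]] : ~ msupport mu x.
  by move=> Sx; have : (U `&` msupport mu) x by []; rewrite US.
have mV : measurable (V : set (measurableTypeR R)) by apply: open_measurable.
have {}V0 : mu V = 0%E.
  by apply/eqP; rewrite eq_le measure_ge0 andbT leNgt; apply/negP.
have /nbhs_ballP[e /= e0 eV] : nbhs x V by apply: open_nbhs_nbhs.
have /rat_in_itvoo[p] : x - e < x by rewrite ltrBlDr ltrDl.
have /rat_in_itvoo[q] : x < x + e by rewrite ltrDl.
rewrite !in_itv /= => /andP[xq qe] /andP[ep px].
exists (pickle (p, q)); [exact: I|rewrite /itv pickleK].
have sub : `](ratr p : R), ratr q[%classic `<=` V.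
  move=> y; rewrite /= in_itv /= => /andP[py yq]; apply: eV.
  by rewrite /ball /= ltr_norml; apply/andP; split; lra.
have V00 : mu `](ratr p : R), ratr q[%classic = 0%E.
  apply/eqP; rewrite eq_le measure_ge0 andbT -V0.
  by apply: le_measure; rewrite ?inE.
by rewrite [(p, q).1]/= [(p, q).2]/= V00 eqxx /= in_itv /= px xq.
Qed.

Lemma msupport_neq0 : msupport mu !=set0.
Proof.
apply/set0P/eqP => S0; have : mu setT = 0%E.
  by apply: open_outside_msupport; [exact: openT|rewrite S0 setI0].
by rewrite probability_setT => /eqP; rewrite eqe oner_eq0.
Qed.

Variable M : R.
Hypothesis supp : msupport mu `<=` `[0, M].
Local Notation D := (`[0, M]%classic : set (measurableTypeR R)).

Lemma mu_setC_itv : mu (~` D) = 0%E.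
Proof.
apply: open_outside_msupport; first exact/closed_openC/interval_closed.
by apply/seteqP; split => // x [/= + /supp].
Qed.

Let mD : measurable D. Proof. exact: measurable_itv. Qed.

Lemma expectation_itv (f : R -> R) : measurable_fun setT (f : measurableTypeR R -> R) ->
  'E_mu[f]%E = (\int[mu]_(x in D) (f x)%:E)%E.
Proof.
move=> mf; rewrite unlock [RHS]integral_mkcond; apply: ae_eq_integral => //.
- exact/measurable_EFinP.
- apply/(measurable_restrictT _ mD); apply: measurable_funTS.
  exact/measurable_EFinP.
- exists (~` D); split; [exact: measurableC|exact: mu_setC_itv|].
  move=> x /= H Dx; apply: H => _; rewrite /patch; case: ifPn => //.
  by rewrite notin_setE.
Qed.

Lemma poly_integrable (p : {poly R}) : mu.-integrable D (EFin \o horner p).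
Proof.
apply: measurable_bounded_integrable => //.
- by apply: (le_lt_trans (probability_le1 mu mD)); rewrite ltry.
- apply/measurable_funTS; apply: continuous_measurable_fun.
  exact/continuous_horner.
- have : compact (horner p @` `[0, M]).
    apply: continuous_compact; last exact: segment_compact.
    exact/continuous_subspaceT/continuous_horner.
  move=> /compact_bounded[N [Nr NP]]; exists N; split=> // y Ny x Dx.
  by apply: (NP y Ny); exists x.
Qed.

(** The moments as a linear functional on polynomials, so that inequalities
    between moments follow from inequalities between polynomials. *)
Definition mom (p : {poly R}) : R := fine 'E_mu[horner p]%E.

Lemma measurable_horner (p : {poly R}) :
  measurable_fun setT (horner p : measurableTypeR R -> R).
Proof. by apply: continuous_measurable_fun; apply/continuous_horner. Qed.

Lemma expectation_mom p : 'E_mu[horner p]%E = (mom p)%:E.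
Proof.
rewrite /mom fineK // expectation_itv; last exact: measurable_horner.
exact: (integrable_fin_num mD (poly_integrable p)).
Qed.

Lemma mom_scalar : scalar mom.
Proof.
have momE q : mom q = (\int[mu]_(x in D) q.[x])%R.
  by rewrite /mom expectation_itv //; apply: measurable_horner.
move=> c p q; rewrite !momE /=.
rewrite -RintegralZl //; last exact: poly_integrable.
rewrite -RintegralD //; first last.
- exact: poly_integrable.
- have -> : (EFin \o (fun x => c * p.[x])) = EFin \o horner (c *: p).
    by apply/funext => x /=; rewrite hornerZ.
  exact: poly_integrable.
by congr fine; apply: eq_integral => x _; rewrite hornerD hornerZ.
Qed.

HB.instance Definition _ := GRing.isLinear.Build R {poly R} R *%R mom mom_scalar.

Lemma mom_ge0 p : (forall x, 0 <= x <= M -> 0 <= p.[x]) -> 0 <= mom p.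
Proof.
move=> p0; rewrite /mom expectation_itv; last exact: measurable_horner.
apply: fine_ge0; apply: integral_ge0 => x; rewrite /= in_itv /= => xM.
by rewrite lee_fin p0.
Qed.

Lemma mom_Xn n : mom 'X^n = fine 'E_mu[fun t : R => t ^+ n].
Proof. by congr (fine ('E_mu[_])); apply/funext => x; rewrite hornerXn. Qed.

Lemma mom1 : mom 1 = 1.
Proof.
have -> : 1 = 'X^0 :> {poly R} by [].
rewrite mom_Xn unlock.
rewrite (eq_integral (cst 1%:E)) => [|x _]; last by rewrite expr0.
rewrite integral_cst // mul1e -[RHS]/(fine 1%E); congr fine; exact: probability_setT.
Qed.

Hypothesis E1 : ('E_mu[idfun] = 1)%E.

Lemma momX : mom 'X = 1.
Proof.
have -> : 'X = 'X^1 :> {poly R} by [].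
rewrite mom_Xn.
have -> : (fun t : R => t ^+ 1) = idfun by apply/funext => x; rewrite expr1.
by rewrite E1.
Qed.

Lemma mom_variance : 'V_mu[idfun]%E = (mom 'X^2 - 1)%:E.
Proof.
rewrite /variance unlock E1 /=.
have -> : ((idfun \- cst 1) * (idfun \- cst 1))%R = horner (('X - 1) ^+ 2 : {poly R}).
  by apply/funext => x; rewrite !hornerE expr2.
rewrite expectation_mom; congr (_%:E).
have -> : ('X - 1) ^+ 2 = 'X^2 - 2 *: 'X + 1 :> {poly R}.
  by rewrite -mul_polyC polyC2; ring.
by rewrite linearD linearB linearZ /= momX mom1; ring.
Qed.

Lemma mom_ub n : 0 <= mom 'X^(n.+1) <= M ^+ n.
Proof.
apply/andP; split.
  by apply: mom_ge0 => x /andP[x0 _]; rewrite hornerXn exprn_ge0.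
rewrite -subr_ge0 -[M ^+ n]mulr1 -momX -linearZ -linearB /=.
apply: mom_ge0 => x /andP[x0 xM]; rewrite !hornerE exprS mulrC -mulrBr.
by rewrite mulr_ge0 // subr_ge0 lerXn2r ?nnegrE // (le_trans x0).
Qed.

Lemma M_ge1 : 1 <= M.
Proof.
rewrite -subr_ge0 -momX -[M]mulr1 -[X in M * X]mom1 -linearZ -linearB /=.
by apply: mom_ge0 => x /andP[x0 xM]; rewrite !hornerE subr_ge0.
Qed.

Lemma mom_X2_ub : mom 'X^2 <= M.
Proof. by have /andP[_] := mom_ub 1; rewrite expr1. Qed.

(** If [B < x], the mass [d > 0] beyond the midpoint [y] forces
    [y ^+ n * d <= mom 'X^n], which outgrows [B ^+ n]. *)
Lemma msupport_ub (B x : R) : 0 < B -> (forall n, mom 'X^(n.+1) <= B ^+ n.+1) ->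
  msupport mu x -> x <= B.
Proof.
move=> B0 mB Sx; rewrite leNgt; apply/negP => Bx.
pose y := (B + x) / 2; pose U : set (measurableTypeR R) := `]y, +oo[%classic.
have By : B < y by rewrite /y; lra.
have mU : measurable U by exact: measurable_itv.
have U0 : (0 < mu U)%E.
  by apply: Sx; [exact: interval_open|rewrite /U /= in_itv /= andbT /y; lra].
have mDU : measurable (D `&` U) by exact: measurableI.
have UDE : (mu U <= mu (D `&` U))%E.
  have mCU : measurable (~` D `&` U) by apply: measurableI => //; exact: measurableC.
  have mCU0 : (mu (~` D `&` U) <= 0)%E.
    by rewrite -mu_setC_itv; apply: le_measure; rewrite ?inE //; exact: measurableC.
  have {1}-> : U = (D `&` U) `|` (~` D `&` U) by rewrite -setIUl setUCr setTI.
  apply: le_trans (measureU2 _ mDU mCU) _.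
  by rewrite -[leRHS]adde0; apply: leeD.
pose d := fine (mu (D `&` U)).
have dfin : mu (D `&` U) = d%:E by rewrite fineK // fin_num_measure.
have d0 : 0 < d by rewrite -lte_fin -dfin; apply: lt_le_trans UDE.
have momd n : y ^+ n * d <= mom 'X^n.
  rewrite -lee_fin -expectation_mom expectation_itv; last exact: measurable_horner.
  rewrite EFinM -dfin -integral_cst //.
  apply: (@le_trans _ _ (\int[mu]_(x in D `&` U) ('X^n).[x]%:E)%E).
    apply: ge0_le_integral => //.
    - by move=> z _; rewrite lee_fin exprn_ge0 //; lra.
    - by apply/measurable_EFinP/measurable_funTS; apply: measurable_horner.
    - move=> z [_]; rewrite /U /= in_itv /= andbT => yz.
      by rewrite lee_fin hornerXn lerXn2r ?nnegrE //; lra.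
  apply: ge0_subset_integral => //.
  - by apply/measurable_EFinP/measurable_funTS; apply: measurable_horner.
  - move=> z; rewrite /= in_itv /= => /andP[z0 _].
    by rewrite lee_fin hornerXn exprn_ge0.
pose t := y / B - 1.
have t0 : 0 < t by rewrite /t subr_gt0 ltr_pdivlMr // mul1r.
have grow n : n%:R * t * d <= 1.
  case: n => [|n]; first by rewrite !mul0r.
  have : (1 + n.+1%:R * t) * d <= 1.
    apply: (@le_trans _ _ ((y / B) ^+ n.+1 * d)).
      apply: ler_wpM2r; first exact: ltW.
      have -> : y / B = 1 + t by rewrite /t addrC subrK.
      elim: (n.+1) => [|m IH]; first by rewrite mul0r addr0 expr0.
      rewrite exprS; apply: le_trans (ler_wpM2l _ IH); last by lra.
      rewrite -natr1 -subr_ge0.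
      have -> : (1 + t) * (1 + m%:R * t) - (1 + (m%:R + 1) * t) = m%:R * t ^+ 2 by ring.
      by rewrite mulr_ge0 ?exprn_ge0 // ltW.
    rewrite expr_div_n mulrAC ler_pdivrMr ?exprn_gt0 // mul1r.
    exact: le_trans (momd _) (mB _).
  by rewrite mulrDl mul1r; apply: le_trans; rewrite lerDr ltW.
have td0 : 0 < t * d by rewrite mulr_gt0.
have := truncnS_gt (t * d)^-1; rewrite ltNge => /negP; apply.
by rewrite -[leRHS]mul1r ler_pdivlMr // mulrA grow.
Qed.
End Support.

(** * Support of the free multiplicative convolution *)

Lemma pal_prod (R : realType) (A : cstarAlgType R) (I : eqType) (b : I -> A) k
    (f : 'I_k -> I) :
  (\prod_(i < k) b (f i)) * (\prod_(i < k) b (f (rev_ord i))) =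
  pal b [seq f i | i <- enum 'I_k].
Proof.
elim: k f => [|k IH] f; first by rewrite !big_ord0 enum_ord0 mulr1.
rewrite enum_ordSl /= -map_comp -(IH (f \o lift ord0)) big_ord_recl big_ord_recr /=.
rewrite -!mulrA; congr (_ * (_ * (_ * _))).
  by apply: eq_bigr => i _; congr (b (f _)); apply/val_inj; rewrite /= /bump /= subSn // addnC.
by congr (b (f _)); apply/val_inj; rewrite /= subnn.
Qed.

Section Moments.
Context {R : realType} {A : cstarAlgType R} (tau : {scalar A}) (a : A).
Variables (mu : probability (measurableTypeR R) R) (L : R).
Local Open Scope complex_scope.
Hypothesis a_mu : has_distribution tau a mu.
Hypothesis supp : msupport mu `<=` `[0, L].

Lemma tau_mom n : tau (a ^+ n) = (mom mu 'X^n)%:C.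
Proof. by rewrite a_mu mom_Xn. Qed.

(** Hence [rtau] is nonnegative on the polynomials in [a] that are nonnegative
    on [0, L], the property needed by [poly_alg_closure]. *)
Lemma rtau_rpoly (p : {poly R}) : rtau tau (rpoly a p) = mom mu p.
Proof.
rewrite -(coefK p) poly_def.
have mom0 : mom mu 0 = 0.
  by have := mom_scalar supp (-1) 0 0; rewrite scaler0 add0r mulN1r addNr.
have momD q1 q2 : mom mu (q1 + q2) = mom mu q1 + mom mu q2.
  by have := mom_scalar supp 1 q1 q2; rewrite scale1r mul1r.
have momZ c q : mom mu (c *: q) = c * mom mu q.
  by have := mom_scalar supp c q 0; rewrite !addr0 mom0 addr0.
have rD q1 q2 : rtau tau (rpoly a (q1 + q2)) = rtau tau (rpoly a q1) + rtau tau (rpoly a q2).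
  by rewrite rpolyD rtauD.
have r0 : rtau tau (rpoly a 0) = 0 by rewrite rpoly0 /rtau linear0.
rewrite (big_morph _ momD mom0) (big_morph (fun q => rtau tau (rpoly a q)) rD r0).
apply: eq_bigr => i _.
rewrite momZ rpolyZ rtauZ; congr (_ * _).
have -> : rpoly a 'X^i = a ^+ i.
  elim: (i : nat) => [|j IH]; first by rewrite !expr0 rpoly1.
  by rewrite !exprS rpolyM IH rpolyX.
by rewrite /rtau tau_mom.
Qed.

End Moments.

Theorem theorem2 (R : realType) :
  exists C : R, 0 < C /\
    forall (k : nat) (L sigma2 : R)
      (mu : 'I_k -> probability (measurableTypeR R) R)
      (nu : probability (measurableTypeR R) R),
      (1 <= k)%N -> 0 < L -> 0 <= sigma2 ->
      (forall i, msupport (mu i) `<=` `[0, L]) ->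
      (forall i, ('E_(mu i)[idfun] = 1)%E) ->
      (forall i, (sigma2%:E <= 'V_(mu i)[idfun])%E) ->
      is_free_mult_conv mu nu ->
      sigma2 * k%:R <= sup (msupport nu) /\
      sup (msupport nu) < C * L * k%:R.
Proof.
exists 37; split=> // k L sigma2 mu nu k1 L0 s0 supp E1 V.
move=> [cpt nneg [A [tau [a [b [st free a_mu b_a nu_x]]]]]].
have tau1 : tau 1 = 1 by case: st.
have a_b i : b i ^+ 2 = a i by case: (b_a i).
have closure i : poly_alg (b i) `<=` L2closure tau (poly_alg (a i)).
  have [[y bE] ab] := b_a i.
  apply: (poly_alg_closure st bE ab L0) => q q0.
  rewrite (rtau_rpoly (a_mu i).2 (supp i)); exact: (mom_ge0 (supp i) q0).
have b_free : forall w : seq ('I_k * A), w <> [::] ->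
    centered_word tau (fun i => poly_alg (b i)) w -> tau (wprod w) = 0.
  apply: (free_L2closure st (B := fun i => poly_alg (a i))) => //.
  - by move=> i; apply: poly_alg1.
  - by move=> i c x y; apply: poly_algD.
  - exact: free_poly_alg.
have mE i n : tau ((b i ^+ 2) ^+ n) = (mom (mu i) 'X^n)%:C%C.
  by rewrite a_b (tau_mom (a_mu i).2).
have m1 i : tau ((b i ^+ 2) ^+ 1) = 1.
  by rewrite mE expr1 (momX (E1 i)).
pose s := enum 'I_k.
have us : uniq s by exact: enum_uniq.
have ss : size s = k by rewrite size_enum_ord.
have xE : (\prod_(i < k) b i) * (\prod_(i < k) b (rev_ord i)) = pal b s.
  by have := pal_prod b (fun i : 'I_k => i); rewrite map_id.
rewrite xE in nu_x.
pose i0 : 'I_k := Ordinal k1.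
have L1 : 1 <= L := M_ge1 (supp i0) (E1 i0).
have L1C : 1 <= L%:C%C by rewrite lecR.
have mL i n : 0 <= tau ((b i ^+ 2) ^+ n.+1) <= L%:C%C ^+ n.
  by rewrite mE -rmorphXn /= !lecR; exact: (mom_ub (supp i) (E1 i)).
have [p1 p2] := pal_moments st b_free L1C m1 mL us.
have bnd n := pal_bound st b_free L1C m1 mL n us.
set S := msupport nu in cpt nneg *.
have S0 : S !=set0 by exact: msupport_neq0.
have Sub : has_ubound S.
  have [N [_ NP]] := compact_bounded cpt.
  exists (N + 1) => x Sx; apply: le_trans (ler_norm _) _.
  by apply: NP Sx; rewrite ltrDl.
have Ssup : S `<=` `[0, sup S].
  move=> x Sx; rewrite /= in_itv /=; apply/andP; split; last exact: ub_le_sup.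
  by have := nneg x Sx; rewrite /= in_itv /= andbT.
have nuE n : tau (pal b s ^+ n) = (mom nu 'X^n)%:C%C by exact: tau_mom.
have E1nu : ('E_nu[idfun] = 1)%E.
  have -> : (idfun : R -> R) = horner 'X by apply/funext => x; rewrite hornerX.
  rewrite (expectation_mom Ssup); congr (_%:E).
  by have := nuE 1; rewrite expr1 p1 => -[].
split.
  apply: le_trans (mom_X2_ub Ssup E1nu).
  have : (mom nu 'X^2)%:C%C = (1 + \sum_(i <- s) (mom (mu i) 'X^2 - 1))%:C%C.
    rewrite -nuE p2 rmorphD rmorph1 rmorph_sum; congr (_ + _).
    by apply: eq_bigr => i _; rewrite mE rmorphB rmorph1.
  move=> [->]; have -> : sigma2 * k%:R = \sum_(i <- s) sigma2.
    by rewrite big_const_seq count_predT iter_addr_0 ss mulr_natr.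
  rewrite -[X in X <= _]add0r; apply: lerD => //; apply: ler_sum => i _.
  by have := V i; rewrite (mom_variance (supp i) (E1 i)) lee_fin.
have k0 : 0 < k%:R :> R by rewrite ltr0n.
apply: (@le_lt_trans _ _ (36 * L * k%:R)); last first.
  by rewrite !ltr_pM2r // ltr_nat.
apply: ge_sup => // x Sx; apply: (msupport_ub Ssup) Sx; first by rewrite !mulr_gt0.
move=> n; have := bnd n; rewrite ss => /(_ k1); rewrite nuE.
have -> : 36%:R * L%:C%C * k%:R = (36 * L * k%:R)%:C%C.
  by rewrite !rmorphM !rmorph_nat.
rewrite -rmorphXn ger0_norm ?lecR //.
by apply: (mom_ge0 Ssup) => z /andP[z0 _]; rewrite hornerXn exprn_ge0.
Qed.
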